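(* Assume that $\operatorname{Im}\mathbb{B}=\mathcal{Q}'$. Then for all $f\in L^1(\mathcal{J};\mathcal{V}')$ and $g\in L^1(\mathcal{J};\mathcal{Q}')$ there exists a unique pair $(u,p)\in L^1(\mathcal{J};\mathcal{V}\times\mathcal{Q})$ such that, for a.e. $t\in\mathcal{J}$, $$\begin{aligned} a(u(t),v)+b(v,p(t))&=\langle f(t),v\rangle_{\mathcal{V}}+\int_0^t\big[k_1(t,s)\,a(u(s),v)+k_2(t,s)\,b(v,p(s))\big]\,ds,\\ b(u(t),q)&=\langle g(t),q\rangle_{\mathcal{Q}}+\int_0^t k_3(t,s)\,b(u(s),q)\,ds,\end{aligned}$$ for all $(v,q)\in\mathcal{V}\times\mathcal{Q}$.
   Context: $\mathcal{V}$ and $\mathcal{Q}$ are real Hilbert spaces with duals $\mathcal{V}',\mathcal{Q}'$; $\langle\cdot,\cdot\rangle_{\mathcal{V}}$ and $\langle\cdot,\cdot\rangle_{\mathcal{Q}}$ are the duality pairings between $\mathcal{V}',\mathcal{V}$ and between $\mathcal{Q}',\mathcal{Q}$. $\mathcal{J}=[0,T]$ with $T\in[0,\infty)$, and $L^1(\mathcal{J};X)$ is the Bochner space. The real-valued kernels $k_1,k_2,k_3$ are continuous and bounded on the triangle $\{(t,s):0\le s\le t\le T\}$, with $|k_i(t,s)|\le C_{k_i}$. $a:\mathcal{V}\times\mathcal{V}\to\mathbb{R}$ is a bilinear form that is symmetric, positive semi-definite and continuous. $b:\mathcal{V}\times\mathcal{Q}\to\mathbb{R}$ is a continuous bilinear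 form, and $\mathbb{B}:\mathcal{V}\to\mathcal{Q}'$ is the induced operator, $\langle\mathbb{B}v,q\rangle_{\mathcal{Q}}=b(v,q)$. With $\mathcal{K}=\ker\mathbb{B}=\{v\in\mathcal{V}: b(v,q)=0\ \forall q\in\mathcal{Q}\}$, there is $\alpha_0>0$ such that $a(v_0,v_0)\ge\alpha_0\|v_0\|_{\mathcal{V}}^2$ for all $v_0\in\mathcal{K}$. *)

(* Defs.v *)
From HB Require Import structures.
From mathcomp Require Import all_boot all_order all_algebra.
From mathcomp Require Import sesquilinear.
From mathcomp Require Import all_classical all_reals all_analysis.

Set Implicit Arguments.
Unset Strict Implicit.
Unset Printing Implicit Defensive.

Import Order.TTheory GRing.Theory Num.Theory.
Import numFieldNormedType.Exports.

Local Open Scope classical_set_scope.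
Local Open Scope ring_scope.

(* Real Hilbert spaces: complete normed modules whose norm comes from an inner
   product. Positive definiteness of [inner] follows from [normr_inner]. *)
HB.mixin Record isHilbert (R : realType) V & CompleteNormedModule R V := {
  inner : V -> V -> R ;
  innerC : forall x y : V, inner x y = inner y x ;
  inner_linearl : forall (c : R) (x y z : V),
    inner (c *: x + y) z = c * inner x z + inner y z ;
  normr_inner : forall x : V, `|x| ^+ 2 = inner x x
}.

#[short(type="hilbertType")]
HB.structure Definition Hilbert (R : realType) :=
  {V of CompleteNormedModule R V & isHilbert R V}.

Section Dual.
Context {R : realType} (X : normedModType R).

Definition dual_pred : {pred X -> R} :=
  fun phi => `[< linear phi /\ continuous phi >].

Record dual := Dual { dual_fun :> X -> R ; dual_funP : dual_fun \in dual_pred }.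

HB.instance Definition _ := [isSub for dual_fun].
HB.instance Definition _ := [Choice of dual by <:].

Fact dual_submod_closed : submod_closed dual_pred.
Proof.
split.
  apply/asboolP; split=> [c x y|]; last exact: cst_continuous.
  by rewrite /= scaler0 addr0.
move=> c phi psi /asboolP[lphi cphi] /asboolP[lpsi cpsi].
apply/asboolP; split=> [d x y|x].
  have E z : (c *: phi + psi) z = c *: phi z + psi z by [].
  rewrite !E lphi lpsi !scalerDr !scalerA mulrC addrACA.
  by rewrite -!addrA.
apply: cvgD; last exact: cpsi.
by apply: cvgZr; exact: cphi.
Qed.

HB.instance Definition _ :=
  GRing.isSubmodClosed.Build R (X -> R) dual_pred dual_submod_closed.
HB.instance Definition _ := [SubChoice_isSubLmodule of dual by <:].

Lemma dual_linear (phi : dual) : linear phi.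
Proof. by have /asboolP[] := dual_funP phi. Qed.

Lemma dual_continuous (phi : dual) : continuous phi.
Proof. by have /asboolP[] := dual_funP phi. Qed.

HB.instance Definition _ (phi : dual) :=
  GRing.isLinear.Build R X R *:%R phi (dual_linear phi).

Definition dual_norm (phi : dual) : R :=
  sup [set `|phi x| | x in [set x : X | `|x| <= 1]].

Lemma dual_norm_has_sup (phi : dual) :
  has_sup [set `|phi x| | x in [set x : X | `|x| <= 1]].
Proof.
split; first by exists `|phi 0|, 0 => //=; rewrite normr0.
have [M hM] := (bounded_funP phi).2
  ((linear_bounded_continuous phi).2 (@dual_continuous phi)) 1.
by exists M => _ [x /= x1 <-]; exact: hM.
Qed.

Lemma dual_norm_ub (phi : dual) (x : X) : `|x| <= 1 -> `|phi x| <= dual_norm phi.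
Proof.
move=> x1; apply: sup_upper_bound; first exact: dual_norm_has_sup.
by exists x.
Qed.

Lemma dual_norm_le (phi : dual) (M : R) :
  (forall x, `|x| <= 1 -> `|phi x| <= M) -> dual_norm phi <= M.
Proof.
move=> hM; apply: ge_sup; first by case: (dual_norm_has_sup phi).
by move=> _ [x /= x1 <-]; exact: hM.
Qed.

Fact dual_normD (phi psi : dual) :
  dual_norm (phi + psi) <= dual_norm phi + dual_norm psi.
Proof.
apply: dual_norm_le => x x1.
by rewrite (le_trans (ler_normD (phi x) (psi x)))// lerD// dual_norm_ub.
Qed.

Fact dual_normZ (c : R) (phi : dual) :
  dual_norm (c *: phi) = `|c| * dual_norm phi.
Proof.
have leZ d psi : dual_norm (d *: psi) <= `|d| * dual_norm psi.
  apply: dual_norm_le => x x1.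
  by rewrite [X in X <= _](normrM d (psi x)) ler_wpM2l// dual_norm_ub.
apply/eqP; rewrite eq_le leZ /=.
have [->|c0] := eqVneq c 0.
  rewrite normr0 mul0r (le_trans _ (@dual_norm_ub _ 0 _))//.
  by rewrite normr0.
rewrite -ler_pdivlMl ?normr_gt0// -normfV.
by rewrite -{1}[phi](scalerK c0) leZ.
Qed.

Fact dual_norm0_eq0 (phi : dual) : dual_norm phi = 0 -> phi = 0.
Proof.
move=> phi0; apply/val_inj/funext => x /=.
have [->|x0] := eqVneq x 0; first by rewrite linear0.
have : `|phi (`|x|^-1 *: x)| <= 0.
  rewrite -phi0 dual_norm_ub// normrZ normfV normr_id mulVf//.
  by rewrite normr_eq0.
rewrite normr_le0 linearZ /= scaler_eq0 invr_eq0 normr_eq0 (negbTE x0).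
by move=> /eqP.
Qed.

HB.instance Definition _ := @Lmodule_isNormed.Build R dual
  dual_norm dual_normD dual_normZ dual_norm0_eq0.

End Dual.

Section Bochner.
Context d {Omega : measurableType d} {R : realType}.
Variable mu : {measure set Omega -> \bar R}.
Context {X : normedModType R}.

Definition simple_function (s : Omega -> X) :=
  finite_set (range s) /\ forall x : X, measurable (s @^-1` [set x]).

Definition strongly_measurable (D : set Omega) (f : Omega -> X) :=
  exists s : nat -> Omega -> X, (forall n, simple_function (s n)) /\
    {ae mu, forall t, D t -> s n t @[n --> \oo] --> f t}.

(* Functions representing an element of the Bochner space L^1(D; X), whose
   elements are classes of such functions modulo equality a.e. on [D]. The norm
   [`|f t|] is measurable only for the completion of [mu]; the library integral
   of a nonnegative function, a supremum over simple functions below it, still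
   gives it the expected value. *)
Definition bochner_L1 (D : set Omega) (f : Omega -> X) :=
  strongly_measurable D f /\ (\int[mu]_(t in D) (`|f t|)%:E < +oo)%E.

End Bochner.

Section InducedOperator.
Context {R : realType} {V Q : normedModType R} (b : {bilinear V -> Q -> R}).
Hypothesis b_cont : continuous (fun x : V * Q => b x.1 x.2).

Fact induced_op_subproof (v : V) : b v \in @dual_pred R Q.
Proof.
apply/asboolP; split=> [c x y|q]; first exact: linearPr.
have := @continuous_comp _ _ _ (fun q : Q => (v, q)) (fun x => b x.1 x.2) q.
apply; last exact: b_cont.
by apply: cvg_pair; [exact: cvg_cst|exact: cvg_id].
Qed.

Definition induced_op (v : V) : dual Q := Dual (induced_op_subproof v).

Definition ker_op : set V := [set v | induced_op v = 0].

End InducedOperator.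

Section VolterraSaddlePoint.
Context {R : realType}.
Local Notation mu := (@lebesgue_measure R).

(* Pairs [(t, s)] with [0 <= s <= t <= T]. *)
Definition triangle (T : R) : set (R * R) :=
  [set x | 0 <= x.2 /\ x.2 <= x.1 /\ x.1 <= T].

Definition volterra_kernel (T : R) (k : R -> R -> R) (C : R) :=
  {within triangle T, continuous (fun x : R * R => k x.1 x.2)} /\
  forall t s, triangle T (t, s) -> `|k t s| <= C.

Definition volterra_saddle_solution {V Q : normedModType R} (T : R)
    (k1 k2 k3 : R -> R -> R)
    (a : {bilinear V -> V -> R}) (b : {bilinear V -> Q -> R})
    (f : R -> dual V) (g : R -> dual Q) (u : R -> V) (p : R -> Q) :=
  {ae mu, forall t, `[0, T]%classic t -> forall (v : V) (q : Q),
    a (u t) v + b v (p t) =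
      f t v + \int[mu]_(s in `[0, t]) (k1 t s * a (u s) v + k2 t s * b v (p s))
    /\
    b (u t) q = g t q + \int[mu]_(s in `[0, t]) (k3 t s * b (u s) q)}.

End VolterraSaddlePoint.

(* Main.v *)
Require Import Defs.
From HB Require Import structures.
From mathcomp Require Import all_boot all_order all_algebra.
From mathcomp Require Import sesquilinear.
From mathcomp Require Import all_classical all_reals all_analysis.
From mathcomp Require Import measurable_realfun ring lra.

Set Implicit Arguments.
Unset Strict Implicit.
Unset Printing Implicit Defensive.

Import Order.TTheory GRing.Theory Num.Theory.
Import numFieldNormedType.Exports.

Local Open Scope classical_set_scope.
Local Open Scope ring_scope.

(** The equations are a Volterra equation of the second kind in the Hilbert
    space V * Q, and the proof separates time from space.

    At a fixed time, the left-hand sides define the saddle-point problem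
    a(u, v) + b(v, p) = phi(v), b(u, q) = psi(q). Let D : Q -> V be the Riesz
    representative of the transpose of B, so that (D q, v) = b(v, q). Since B is
    onto, the uniform boundedness principle gives beta |q| <= |D q| (lemma
    [inf_sup]): each functional on Q is of the form b(v, _), so the q with
    |D q| <= 1 form a weakly bounded set. Hence the Gram form (D z, D q) is
    coercive on Q. Solving with it, and with a on the kernel of B, gives
    existence ([saddle_exists]) and a bound of the solution by the data
    ([saddle_stable]). All these problems are symmetric and coercive, hence
    minimisation problems, and [symmetric_lax_milgram] solves them all, the
    Riesz theorem included.

    In time, the memory integrals are scalar integrals, which form a bounded
    functional of the test vectors. Applying the stationary solution operator to
    this functional gives the [memory_operator] K, and the equations at time t
    say x(t) = h(t) + (K x)(t), where x = (u, p) and h solves the stationary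
    problem with data f and g ([saddle_equationsP]). Two properties of K are
    enough: K x is a continuous function of time for each
    integrable x, by dominated convergence, and
    |K x - K y|(t) <= C * int_0^t |x - y|. With the weight exp(2 C t), the
    second one halves distances. So the Picard iterates started at h differ by
    continuous functions that converge uniformly, which gives a solution
    ([volterra_exists]), and the integrated difference of two solutions
    vanishes ([volterra_unique]).

    Elements of the Bochner space are replaced by representatives that are
    limits of simple functions at every point of the interval
    ([bochner_version]). The integrals do not see the change, even though the
    original functions are measurable only up to a null set
    ([ae_eq_integral_nonmeasurable]). *)

(** * Symmetric coercive forms *)

(** Both the minimising sequences and the Picard iterates below are built with
    geometrically small steps, and their limits come from this lemma. *)
Lemma geometric_cvg (R : realType) (X : completeNormedModType R)
    (u : nat -> X) (A : R) :
  (forall n, `|u n.+1 - u n| <= A * 2^-1 ^+ n) ->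
  exists l : X, u n @[n --> \oo] --> l.
Proof.
move=> uA.
have half : `|2^-1 : R| < 1 by rewrite ger0_norm ?invr_ge0// invf_lt1// ltr1n.
have cS : cvgn [normed series (telescope u)].
  apply: (series_le_cvg (v_ := geometric A 2^-1)) => [n|n|n|] //.
  - exact: normr_ge0.
  - exact: le_trans (uA n).
  - exact: uA.
  - by apply: (@is_cvg_geometric_series R A 2^-1).
have /normed_cvg cu := cS.
exists (u 0%N + limn (series (telescope u))).
have h : u 0%N + series (telescope u) n @[n --> \oo] -->
    u 0%N + limn (series (telescope u)).
  by apply: cvgD => //; exact: cvg_cst.
apply: cvg_trans h; apply: near_eq_cvg; apply: nearW => n.
by rewrite -eq_sum_telescope.
Qed.

Section SymmetricForm.
Context {R : realType} (X : completeNormedModType R).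
Variables (c : X -> X -> R) (M : R).
Hypothesis c_linear : forall k x y z, c (k *: x + y) z = k * c x z + c y z.
Hypothesis c_sym : forall x y, c x y = c y x.
Hypothesis c_bounded : forall x y, `|c x y| <= M * `|x| * `|y|.

Lemma form_sqrD s t x y : c (s *: x + t *: y) (s *: x + t *: y) =
  s ^+ 2 * c x x + 2 * s * t * c x y + t ^+ 2 * c y y.
Proof.
have c0 z : c 0 z = 0.
  by have := c_linear 1 0 0 z; rewrite scaler0 addr0 mul1r; lra.
have cl z : c (s *: x + t *: y) z = s * c x z + t * c y z.
  by rewrite c_linear -[t *: y]addr0 c_linear c0 addr0.
rewrite cl (c_sym x) (c_sym y) !cl (c_sym y x); ring.
Qed.

(** The solution is the minimiser on [K] of J(v) = c(v, v) - 2 phi(v). By the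
    parallelogram identity and coercivity, points at which J is close to its
    infimum are close to each other, so a minimising sequence converges;
    comparing values of J along lines gives the Euler equation. *)
Lemma symmetric_lax_milgram (K : set X) (alpha : R) (phi : X -> R) (N : R) :
  K 0 -> (forall k x y, K x -> K y -> K (k *: x + y)) -> closed K ->
  0 < alpha -> (forall x, K x -> alpha * `|x| ^+ 2 <= c x x) ->
  (forall k x y, phi (k *: x + y) = k * phi x + phi y) ->
  (forall x, `|phi x| <= N * `|x|) ->
  exists2 u, K u & forall v, K v -> c u v = phi v.
Proof.
move=> K0 Klin Kclosed alpha0 coer phi_lin phi_bnd.
have phi0 : phi 0 = 0.
  by have := phi_lin 1 0 0; rewrite scaler0 addr0 mul1r; lra.
have phiD s t x y : phi (s *: x + t *: y) = s * phi x + t * phi y.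
  by rewrite phi_lin -[t *: y]addr0 phi_lin phi0 addr0.
have KD s t x y : K x -> K y -> K (s *: x + t *: y).
  by move=> Kx Ky; apply: (Klin) => //; rewrite -[_ *: y]addr0; exact: Klin.
pose J v := c v v - 2 * phi v.
have Jlb v : K v -> - (N ^+ 2 / alpha) <= J v.
  move=> Kv; have := coer _ Kv; have := le_trans (ler_norm _) (phi_bnd v).
  rewrite /J => h1 h2.
  have : 0 <= (alpha * `|v| - N) ^+ 2 / alpha.
    by rewrite divr_ge0 ?sqr_ge0// ltW.
  have -> : (alpha * `|v| - N) ^+ 2 / alpha =
     alpha * `|v| ^+ 2 - 2 * (N * `|v|) + N ^+ 2 / alpha.
    by field; rewrite gt_eqF.
  by lra.
pose m := inf [set J v | v in K].
have Jinf : has_inf [set J v | v in K].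
  split; first by exists (J 0), 0.
  by exists (- (N ^+ 2 / alpha)) => _ [v Kv <-]; exact: Jlb.
have Jm v : K v -> m <= J v.
  by move=> Kv; apply: ge_inf; [case: Jinf|exists v].
(* If [J (u n)] exceeds the infimum by at most [e n], the parallelogram identity
   bounds the squared step by 4^-n, which suits [geometric_cvg]. *)
pose e n : R := alpha / 4 * (4^-1 ^+ n).
have e0 n : 0 < e n by rewrite /e mulr_gt0// ?divr_gt0// exprn_gt0// invr_gt0.
have /choice [u uP] : forall n, exists v, K v /\ J v < m + e n.
  move=> n; have [_ [v Kv <-] Jv] := inf_adherent (e0 n) Jinf.
  by exists v.
have uK n : K (u n) by case: (uP n).
have ucvg n : `|u n.+1 - u n| <= 1 * 2^-1 ^+ n.
  have := Jm _ (KD 2^-1 2^-1 _ _ (uK n.+1) (uK n)).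
  have -> : J (2^-1 *: u n.+1 + 2^-1 *: u n) =
      2^-1 * J (u n.+1) + 2^-1 * J (u n) -
      4^-1 * c (u n.+1 - u n) (u n.+1 - u n).
    rewrite -[X in c X _](scale1r (u n.+1 - u n)).
    rewrite (_ : 1 *: (u n.+1 - u n) = 1 *: u n.+1 + (-1) *: u n); last first.
      by rewrite !scale1r scaleN1r.
    rewrite (_ : u n.+1 - u n = 1 *: u n.+1 + (-1) *: u n); last first.
      by rewrite !scale1r scaleN1r.
    by rewrite /J !form_sqrD phiD; field.
  have [_ h1] := uP n; have [_ h2] := uP n.+1.
  rewrite (_ : e n.+1 = e n * 4^-1) in h2; last by rewrite /e exprSr mulrA.
  have h3 := coer _ (KD 1 (-1) _ _ (uK n.+1) (uK n)).
  rewrite !scale1r scaleN1r in h3 => h4.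
  have h5 : alpha * `|u n.+1 - u n| ^+ 2 <= 4 * e n by have := e0 n; lra.
  have h6 : 4 * e n = alpha * (2^-1 ^+ n) ^+ 2.
    rewrite /e -exprM mulnC exprM (_ : 2^-1 ^+ 2 = 4^-1 :> R); last by field.
    by field.
  rewrite h6 ler_pM2l// ler_sqr ?nnegrE ?exprn_ge0 ?invr_ge0// in h5.
  by rewrite mul1r.
have [l ul] := geometric_cvg ucvg.
have Kl : K l.
  by apply: (closed_cvg K Kclosed _ _ ul); apply: nearW => n; exact: uK.
exists l => // v Kv.
have cvgc : c (u n) v @[n --> \oo] --> c l v.
  apply/cvgrPdist_le => eps eps0.
  have Mv : 0 < `|M| * `|v| + 1 by rewrite ltr_wpDl// mulr_ge0.
  have /cvgrPdist_le /(_ (eps / (`|M| * `|v| + 1))) := ul.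
  rewrite divr_gt0// => /(_ isT); apply: filterS => n hn.
  have -> : c l v - c (u n) v = c (l - u n) v.
    rewrite (_ : l - u n = (-1) *: u n + l) ?c_linear; first by ring.
    by rewrite scaleN1r addrC.
  apply: le_trans (c_bounded _ _) _.
  apply: (@le_trans _ _ (`|l - u n| * (`|M| * `|v| + 1))); last first.
    by rewrite -ler_pdivlMr.
  rewrite mulrDr mulr1 mulrCA mulrA ler_wpDr//.
  by rewrite ler_wpM2r// ler_wpM2r// ler_norm.
(* [J (u n)] tends to the infimum, so comparing [u n] with
   [u n + s *: v] gives this in the limit. *)
have quad s : 0 <= 2 * s * (c l v - phi v) + s ^+ 2 * c v v.
  pose f n := 2 * s * (c (u n) v - phi v) + s ^+ 2 * c v v + e n.
  have fcvg : f n @[n --> \oo] --> 2 * s * (c l v - phi v) + s ^+ 2 * c v v + 0.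
    apply: cvgD; last first.
      apply: cvg_geometric; rewrite ger0_norm ?invr_ge0// invf_lt1// ltr1n//.
    apply: cvgD; last exact: cvg_cst.
    by apply: cvgMr; apply: cvgB => //; exact: cvg_cst.
  rewrite addr0 in fcvg.
  apply: (cvgr_to_ge fcvg).
  apply: nearW => n; have := Jm _ (KD 1 s _ _ (uK n) Kv).
  have [_] := uP n; rewrite /J form_sqrD phiD /f; lra.
have q0 : 0 <= c v v.
  by apply: le_trans (coer _ Kv); rewrite mulr_ge0 ?sqr_ge0// ltW.
apply/eqP; rewrite -subr_eq0; set d := _ - _ in quad *.
(* The minimising s is - d / c(v, v), but c(v, v) may vanish. *)
have := quad (- d / (c v v + 1)).
set q := c v v in q0 *; have q1 : 0 < q + 1 by lra.
have -> : 2 * (- d / (q + 1)) * d + (- d / (q + 1)) ^+ 2 * q =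
  - (d ^+ 2 * ((q + 2) / (q + 1) ^+ 2)) by field; rewrite gt_eqF.
rewrite oppr_ge0 pmulr_lle0; last by rewrite divr_gt0 ?exprn_gt0//; lra.
by move=> h; rewrite -sqrf_eq0 eq_le h sqr_ge0.
Qed.

End SymmetricForm.

(** * The stationary saddle-point problem *)

Section Saddle.
Context {R : realType}.

(** Plain functions rather than elements of [dual], because the memory terms are
    produced as functions of the test vector. *)
Definition bounded_functional (X : normedModType R) (phi : X -> R) :=
  (forall k x y, phi (k *: x + y) = k * phi x + phi y) /\
  exists N, forall x, `|phi x| <= N * `|x|.

Lemma bounded_functionalB (X : normedModType R) (phi psi : X -> R) :
  bounded_functional phi -> bounded_functional psi ->
  bounded_functional (fun x => phi x - psi x).
Proof.
move=> [lphi [N Nphi]] [lpsi [N' Npsi]]; split => [k x y|].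
  by rewrite lphi lpsi; ring.
exists (N + N') => x; rewrite mulrDl (le_trans (ler_normB _ _))//.
exact: lerD.
Qed.

Lemma bounded_functional_continuous (X : normedModType R) (phi : X -> R) :
  bounded_functional phi -> continuous phi.
Proof.
move=> [lphi [N Nphi]] x; apply/cvgrPdist_le => e e0.
have N0 : 0 < `|N| + 1 by rewrite ltr_wpDl.
have /cvgrPdist_le/(_ (e / (`|N| + 1))) := @cvg_id _ (nbhs x).
rewrite divr_gt0// => /(_ isT); apply: filterS => y xy.
have -> : phi x - phi y = phi (x - y).
  by rewrite (_ : x - y = (-1) *: y + x) ?lphi ?scaleN1r 1?addrC//; ring.
rewrite (le_trans (Nphi _))// (@le_trans _ _ ((`|N| + 1) * `|x - y|))//.
  by rewrite ler_wpM2r// (le_trans (ler_norm N))// lerDl.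
by rewrite mulrC -ler_pdivlMr.
Qed.

Section Inner.
Context {H : hilbertType R}.
Implicit Types x y z : H.

Lemma innerBl x y z : inner (x - y) z = inner x z - inner y z.
Proof.
by rewrite addrC -scaleN1r inner_linearl mulN1r addrC.
Qed.

Lemma inner0l z : inner (0 : H) z = 0.
Proof. by rewrite -(subrr z) innerBl subrr. Qed.

Lemma innerZl k x z : inner (k *: x) z = k * inner x z.
Proof. by rewrite -[k *: x]addr0 inner_linearl inner0l addr0. Qed.

Lemma innerBr x y z : inner z (x - y) = inner z x - inner z y.
Proof. by rewrite innerC innerBl !(innerC z). Qed.

Lemma cauchy_schwarz x y : `|inner x y| <= `|x| * `|y|.
Proof.
have [->|x0] := eqVneq x 0; first by rewrite inner0l !normr0 mul0r.
have [->|y0] := eqVneq y 0; first by rewrite innerC inner0l !normr0 mulr0.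
have xy0 : 0 < `|x| * `|y| by rewrite mulr_gt0// normr_gt0.
have ge0 s t : 0 <= inner (s *: x + t *: y) (s *: x + t *: y).
  by rewrite -normr_inner sqr_ge0.
have := ge0 `|y| (- `|x|); have := ge0 `|y| `|x|.
rewrite !(form_sqrD (@inner_linearl R H) (@innerC R H)) -!normr_inner.
have -> : `|y| ^+ 2 * `|x| ^+ 2 + 2 * `|y| * `|x| * inner x y +
  `|x| ^+ 2 * `|y| ^+ 2 = 2 * (`|x| * `|y|) * (`|x| * `|y| + inner x y) by ring.
have -> : `|y| ^+ 2 * `|x| ^+ 2 + 2 * `|y| * - `|x| * inner x y +
  (- `|x|) ^+ 2 * `|y| ^+ 2 = 2 * (`|x| * `|y|) * (`|x| * `|y| - inner x y).
  by ring.
have xy2 : 0 < 2 * (`|x| * `|y|) by rewrite mulr_gt0.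
rewrite !(pmulr_rge0 _ xy2) => h1 h2.
by rewrite ler_norml; apply/andP; split; lra.
Qed.

Lemma inner_functional x : bounded_functional (inner x).
Proof.
split=> [k y z|]; last by exists `|x| => y; exact: cauchy_schwarz.
by rewrite innerC inner_linearl !(innerC x).
Qed.

Lemma riesz (phi : H -> R) : bounded_functional phi ->
  exists z, forall x, inner z x = phi x.
Proof.
move=> [lphi [N Nphi]].
have bnd x y : `|inner x y| <= 1 * `|x| * `|y|.
  by rewrite mul1r cauchy_schwarz.
have coer x : [set: H] x -> 1 * `|x| ^+ 2 <= inner x x.
  by rewrite mul1r normr_inner.
have [z _ zP] := symmetric_lax_milgram (@inner_linearl R H) (@innerC R H)
  bnd I (fun _ _ _ _ _ => I) closedT ltr01 coer lphi Nphi.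
by exists z => x; exact: zP.
Qed.

End Inner.

Lemma bilinear_functional_l (X Y : normedModType R)
    (c : {bilinear X -> Y -> R}) y :
  continuous (fun x : X * Y => c x.1 x.2) -> bounded_functional (c^~ y).
Proof.
move=> /bilinear_schwarz[M _ Mc]; split=> [k x z|]; first exact: linearPl.
by exists (M * `|y|) => x; rewrite mulrAC.
Qed.

Lemma bilinear_functional_r (X Y : normedModType R)
    (c : {bilinear X -> Y -> R}) x :
  continuous (fun x : X * Y => c x.1 x.2) -> bounded_functional (c x).
Proof.
move=> /bilinear_schwarz[M _ Mc]; split=> [k y z|]; first exact: linearPr.
by exists (M * `|x|) => y.
Qed.

Context {V Q : hilbertType R}.
Variables (a : {bilinear V -> V -> R}) (b : {bilinear V -> Q -> R}).
Hypothesis b_cont : continuous (fun x : V * Q => b x.1 x.2).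

(** [D] is the transpose of B, with values in V through the Riesz theorem. *)
Lemma adjoint_exists : exists D : Q -> V, forall v q, inner (D q) v = b v q.
Proof.
have /choice[D DP] q : exists d, forall v, inner d v = b v q.
  exact/riesz/bilinear_functional_l.
by exists D.
Qed.

Lemma adjoint_linear (D : Q -> V) : (forall v q, inner (D q) v = b v q) ->
  forall k q q', D (k *: q + q') = k *: D q + D q'.
Proof.
move=> DP k q q'; apply/subr0_eq/eqP; rewrite -normr_eq0 -sqrf_eq0 normr_inner.
by rewrite innerBl inner_linearl !DP linearPr subrr.
Qed.

Lemma adjoint_bounded (D : Q -> V) : (forall v q, inner (D q) v = b v q) ->
  exists2 M, 0 <= M & forall q, `|D q| <= M * `|q|.
Proof.
have [M M0 bM] := bilinear_schwarz b_cont.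
move=> DP; exists M => [|q]; first exact: ltW.
have [->|Dq0] := eqVneq `|D q| 0; first by rewrite mulr_ge0// ltW.
have Dq : 0 < `|D q| by rewrite lt_neqAle eq_sym Dq0 normr_ge0.
rewrite -(ler_pM2r Dq) -expr2 normr_inner DP mulrAC.
exact: le_trans (ler_norm _) (bM _ _).
Qed.

Lemma ker_opE v : ker_op b_cont v <-> forall q, b v q = 0.
Proof.
split=> [bv q|bv]; last by apply/val_inj/funext => q; exact: bv.
by have := congr1 (fun phi : dual Q => phi q) bv.
Qed.

Hypothesis B_onto : range (induced_op b_cont) = [set: dual Q].

(** The set of all q with |D q| <= 1 is weakly bounded: by surjectivity each
    (w, _) is some b(v, _), and |b(v, q)| = |(D q, v)| <= |v| on this set. By
    the uniform boundedness principle it is bounded in norm. *)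
Lemma inf_sup (D : Q -> V) : (forall v q, inner (D q) v = b v q) ->
  exists2 beta, 0 < beta & forall q, beta * `|q| <= `|D q|.
Proof.
move=> DP.
have D0 : D 0 = 0.
  by have := adjoint_linear DP (-1) 0 0; rewrite !scaleN1r oppr0 addr0 addNr.
have DZ k q : D (k *: q) = k *: D q.
  by rewrite -[k *: q]addr0 (adjoint_linear DP) D0 addr0.
pose F : set (Q -> R) := [set inner q | q in [set q | `|D q| <= 1]].
have F_bl (f : Q -> R) : F f -> bounded_fun_norm f /\ linear f.
  move=> [q _ <-]; have [lq [N Nq]] := inner_functional q.
  split=> // r; exists (`|N| * r) => x xr.
  rewrite (le_trans (Nq x))// (le_trans (ler_wpM2r _ (ler_norm N)))//.
  by rewrite ler_wpM2l.
have F_pb : pointwise_bounded F.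
  move=> w.
  have w_dual : (inner w : Q -> R) \in @dual_pred R Q.
    have bw := inner_functional w; apply/asboolP; split; first by case: bw.
    exact: bounded_functional_continuous.
  have [v _ vw] : range (induced_op b_cont) (Dual w_dual) by rewrite B_onto.
  exists `|v| => f [q /= Dq1 <-].
  have -> : inner q w = b v q.
    by have := congr1 (fun phi : dual Q => phi q) vw => /= ->; rewrite innerC.
  rewrite -DP (le_trans (cauchy_schwarz _ _))//.
  by rewrite -[leRHS]mul1r ler_wpM2r.
have [M FM] := Banach_Steinhauss F_bl F_pb 1.
pose N := `|M| + 1; have N0 : 0 < N by rewrite /N ltr_wpDl.
have small q : `|D q| <= 1 -> `|q| <= N.
  move=> Dq; have [->|q0] := eqVneq q 0; first by rewrite normr0 ltW.
  have nq0 : `|q| != 0 by rewrite normr_eq0.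
  have Fq : F (inner q) by exists q.
  have := FM _ Fq (`|q|^-1 *: q).
  rewrite normrZ normfV normr_id mulVf// lexx => /(_ isT).
  rewrite innerC innerZl -normr_inner expr2 mulKf// normr_id => qM.
  by rewrite (le_trans qM)// (le_trans (ler_norm M))// lerDl.
exists N^-1; first by rewrite invr_gt0.
move=> q; rewrite ler_pdivrMl//.
(* [D q] is not yet known to be nonzero, so q is scaled by |D q| + e / N. *)
apply/ler_addgt0Pr => e e0.
have De : 0 < `|D q| + e / N by rewrite ltr_wpDl// divr_gt0.
have := small ((`|D q| + e / N)^-1 *: q).
rewrite DZ !normrZ normfV gtr0_norm// ler_pdivrMl// ler_pdivrMl// mulr1.
rewrite lerDl ltW ?divr_gt0// => /(_ isT) /le_trans; apply.
by rewrite mulrDl divfK ?gt_eqF// mulrC.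
Qed.

Hypothesis a_sym : forall u v : V, a u v = a v u.
Hypothesis a_cont : continuous (fun x : V * V => a x.1 x.2).
Variable alpha0 : R.
Hypothesis alpha0_gt0 : 0 < alpha0.
Hypothesis a_coercive : forall v0 : V, ker_op b_cont v0 ->
    alpha0 * `|v0| ^+ 2 <= a v0 v0.

(** The problem D^* D z = psi. It lifts psi to V boundedly, since v = D z
    satisfies b(v, q) = psi(q), and it also yields the multiplier p. *)
Lemma gram_solve (D : Q -> V) (psi : Q -> R) :
  (forall v q, inner (D q) v = b v q) -> bounded_functional psi ->
  exists z, forall q, inner (D z) (D q) = psi q.
Proof.
move=> DP [lpsi [N Npsi]].
have [beta beta0 Dbeta] := inf_sup DP.
have [M M0 DM] := adjoint_bounded DP.
have lin k x y z : inner (D (k *: x + y)) (D z) =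
    k * inner (D x) (D z) + inner (D y) (D z).
  by rewrite (adjoint_linear DP) inner_linearl.
have bnd x y : `|inner (D x) (D y)| <= (M * M) * `|x| * `|y|.
  rewrite (le_trans (cauchy_schwarz _ _))// -mulrA mulrACA.
  by rewrite ler_pM.
have coer q : [set: Q] q -> beta ^+ 2 * `|q| ^+ 2 <= inner (D q) (D q).
  move=> _; rewrite -normr_inner -exprMn ler_sqr ?nnegrE//.
  by rewrite mulr_ge0// ltW.
have beta2 : 0 < beta ^+ 2 by rewrite exprn_gt0.
have [z _ zP] := symmetric_lax_milgram lin (fun x y => innerC (D x) (D y))
  bnd I (fun _ _ _ _ _ => I) closedT beta2 coer lpsi Npsi.
by exists z => q; exact: zP.
Qed.

(** D z lifts psi, and u0 in ker B corrects it so that the residual r of the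
    first equation vanishes on ker B. Such an r is represented by an element of
    the range of D: if D p is its projection on this range, the error e lies in
    ker B, so that |e|^2 = (D p, e) - r(e) = b(e, p) - r(e) = 0. *)
Lemma saddle_exists (phi : V -> R) (psi : Q -> R) :
  bounded_functional phi -> bounded_functional psi ->
  exists x : V * Q, forall v q, a x.1 v + b v x.2 = phi v /\ b x.1 q = psi q.
Proof.
move=> bphi bpsi.
have [D DP] := adjoint_exists.
have [z zP] := gram_solve DP bpsi.
have [M _ Ma] := bilinear_schwarz a_cont.
pose K : set V := [set v | forall q, b v q = 0].
have Kclosed : closed K.
  rewrite (_ : K = \bigcap_q ((b^~ q) @^-1` [set 0])); last first.
    apply/seteqP; split=> v /= Kv; first by move=> q _; exact: Kv.
    by move=> q; exact: Kv.
  apply: closed_bigI => q _; apply: closed_comp; last exact: closed_eq.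
  move=> v _; apply: bounded_functional_continuous.
  exact: bilinear_functional_l.
have K0 : K 0 by move=> q; rewrite linear0l.
have Klin k x y : K x -> K y -> K (k *: x + y).
  by move=> Kx Ky q; rewrite linearPl Kx Ky /= scaler0 addr0.
have Kcoer v : K v -> alpha0 * `|v| ^+ 2 <= a v v.
  by move=> Kv; apply: a_coercive; apply/ker_opE.
have lin k x y v : a (k *: x + y) v = k * a x v + a y v by exact: linearPl.
have [lf [N Nf]] :=
  bounded_functionalB bphi (bilinear_functional_r (D z) a_cont).
have [u0 Ku0 u0P] := symmetric_lax_milgram lin a_sym Ma K0 Klin Kclosed
  alpha0_gt0 Kcoer lf Nf.
pose u := u0 + D z.
have br := bounded_functionalB bphi (bilinear_functional_r u a_cont).
set r := (fun v => phi v - a u v) in br.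
have rK v : K v -> r v = 0.
  by move=> Kv; rewrite /r /u linearDl/= (u0P _ Kv); ring.
have bw : bounded_functional (fun q => r (D q)).
  have [lr [N' Nr]] := br; split=> [k q q'|].
    by rewrite (adjoint_linear DP) lr.
  have [Mb _ bM] := adjoint_bounded DP.
  exists (`|N'| * Mb) => q; rewrite (le_trans (Nr _))//.
  by rewrite (le_trans (ler_wpM2r _ (ler_norm _)))// -mulrA ler_wpM2l.
have [p pP] := gram_solve DP bw.
(* [d] represents r, and D p - d is orthogonal to the range of D, that is, in
   ker B. *)
have [d dP] := riesz br.
have Kd : K (D p - d).
  by move=> q; rewrite -DP innerBr (innerC _ d) dP innerC pP subrr.
have dE : D p - d = 0.
  apply/eqP; rewrite -normr_eq0 -sqrf_eq0 normr_inner {1}innerBl dP rK//.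
  by rewrite DP Kd subrr.
exists (u, p) => v q /=; split.
  rewrite -DP (subr0_eq dE) dP /r; ring.
by rewrite /u linearDl/= Ku0 add0r -DP innerC zP.
Qed.

Lemma ler_sqr_cancel (k x y : R) :
  0 <= x -> 0 <= y -> k * x ^+ 2 <= y * x -> k * x <= y.
Proof.
move=> x0 y0; have [->|xn0] := eqVneq x 0; first by rewrite !mulr0.
have xp : 0 < x by rewrite lt_neqAle eq_sym xn0.
by rewrite expr2 mulrA ler_pM2r.
Qed.

(** The decomposition used for existence is available for any u: u = u0 + D z
    with u0 in ker B. The constraint bounds D z through [inf_sup], coercivity on
    ker B then bounds u0, and the first equation tested with v = D p bounds p. *)
Lemma saddle_stable : exists2 S, 0 <= S & forall (x : V * Q) e, 0 <= e ->
  (forall v, `|a x.1 v + b v x.2| <= e * `|v|) ->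
  (forall q, `|b x.1 q| <= e * `|q|) -> `|x| <= S * e.
Proof.
have [D DP] := adjoint_exists.
have [beta beta0 Dbeta] := inf_sup DP.
have [M /ltW M0 Ma] := bilinear_schwarz a_cont.
pose Sz := beta^-1; pose S0 := (1 + M * Sz) / alpha0; pose Su := S0 + Sz.
pose Sp := (1 + M * Su) / beta.
have Sz0 : 0 <= Sz by rewrite invr_ge0 ltW.
have S00 : 0 <= S0.
  by rewrite divr_ge0 ?addr_ge0 ?mulr_ge0// ltW.
have Su0 : 0 <= Su by rewrite addr_ge0.
have Sp0 : 0 <= Sp.
  by rewrite divr_ge0 ?addr_ge0 ?mulr_ge0// ltW.
exists (Su + Sp) => [|[u p] e e0 /= hv hq]; first by rewrite addr_ge0.
have [z zP] := gram_solve DP (bilinear_functional_r u b_cont).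
have Dz : `|D z| <= Sz * e.
  rewrite /Sz ler_pdivlMl//; apply: ler_sqr_cancel => //.
  rewrite normr_inner zP (@le_trans _ _ (beta * (e * `|z|)))//.
    by rewrite ler_pM2l// (le_trans (ler_norm _)).
  by rewrite mulrCA ler_wpM2l.
pose u0 := u - D z.
have bu0 q : b u0 q = 0.
  by rewrite /u0 linearBl/= -zP -DP (innerC (D q)) subrr.
have u0le : `|u0| <= S0 * e.
  rewrite /S0 mulrAC ler_pdivlMr// mulrC.
  apply: ler_sqr_cancel => //.
    by rewrite mulr_ge0// addr_ge0// mulr_ge0.
  apply: le_trans (a_coercive (proj2 (ker_opE u0) bu0)) _.
  have -> : a u0 u0 = (a u u0 + b u0 p) - a (D z) u0.
    by rewrite bu0 addr0 {1}/u0 linearBl.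
  rewrite (le_trans (ler_norm _))// (le_trans (ler_normB _ _))//.
  rewrite mulrDl mul1r mulrDl lerD// (le_trans (Ma _ _))//.
  by rewrite ler_wpM2r// -mulrA ler_wpM2l.
have ule : `|u| <= Su * e.
  rewrite -(subrK (D z) u) (le_trans (ler_normD _ _))// mulrDl.
  by rewrite lerD.
have ple : `|p| <= Sp * e.
  rewrite /Sp mulrAC ler_pdivlMr// mulrC (le_trans (Dbeta _))//.
  rewrite -[`|D p|]mul1r; apply: ler_sqr_cancel => //.
    by rewrite mulr_ge0// addr_ge0// mulr_ge0.
  rewrite mul1r normr_inner DP.
  have -> : b (D p) p = (a u (D p) + b (D p) p) - a u (D p) by ring.
  rewrite (le_trans (ler_norm _))// (le_trans (ler_normB _ _))//.
  rewrite mulrDl mul1r mulrDl lerD// (le_trans (Ma _ _))//.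
  by rewrite ler_wpM2r// -mulrA ler_wpM2l.
rewrite /Num.norm /= ge_max; apply/andP; split.
  by rewrite (le_trans ule)// ler_wpM2r// lerDl.
by rewrite (le_trans ple)// ler_wpM2r// lerDr.
Qed.

End Saddle.

(** * Strong measurability *)

Section StrongMeasurability.
Context d {Omega : measurableType d} {R : realType}.
Implicit Types X Y : normedModType R.

(** Strong measurability without an exceptional null set. It passes through
    continuous maps and makes norms and scalar products measurable. *)
Definition pw_measurable X (D : set Omega) (f : Omega -> X) :=
  exists s : nat -> Omega -> X, (forall n, simple_function (s n)) /\
    forall t, D t -> s n t @[n --> \oo] --> f t.

Lemma simple_preimage X (s : Omega -> X) (A : set X) :
  simple_function s -> measurable (s @^-1` A).
Proof.
move=> [fs ms].
rewrite (_ : s @^-1` A = \bigcup_(x in range s `&` A) (s @^-1` [set x])).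
  by apply: fin_bigcup_measurable => [|x _]; [exact: finite_setIl|exact: ms].
apply/seteqP; split=> [t At|t [x [_ Ax] /= ->]] //=.
by exists (s t) => //; split => //; exists t.
Qed.

Lemma simple_comp X Y (phi : X -> Y) (s : Omega -> X) :
  simple_function s -> simple_function (phi \o s).
Proof.
move=> ss; split=> [|y]; last exact: (@simple_preimage X s (phi @^-1` [set y])).
by case: ss => fs _; rewrite -(image_comp s phi); exact: finite_image.
Qed.

Lemma simple_pair X Y (s : Omega -> X) (r : Omega -> Y) :
  simple_function s -> simple_function r ->
  simple_function (fun t => (s t, r t) : X * Y).
Proof.
move=> [fs ms] [fr mr]; split=> [|[x y]].
  apply: (@sub_finite_set _ _ (range s `*` range r)).
    by move=> _ [t _ <-]; split; exists t.
  exact: finite_setX.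
rewrite (_ : _ @^-1` _ = s @^-1` [set x] `&` r @^-1` [set y]).
  exact: measurableI.
by apply/seteqP; split=> t /= [-> ->].
Qed.

Lemma pw_measurable_comp X Y (phi : X -> Y) (D : set Omega) (f : Omega -> X) :
  continuous phi -> pw_measurable D f -> pw_measurable D (phi \o f).
Proof.
move=> cphi [s [ss sf]]; exists (fun n => phi \o s n); split=> [n|t Dt].
  exact: simple_comp.
by apply: continuous_cvg; [exact: cphi|exact: sf].
Qed.

Lemma pw_measurable_pair X Y (D : set Omega) (f : Omega -> X) (g : Omega -> Y) :
  pw_measurable D f -> pw_measurable D g ->
  pw_measurable D (fun t => (f t, g t) : X * Y).
Proof.
move=> [s [ss sf]] [r [sr rg]].
exists (fun n t => (s n t, r n t)); split=> [n|t Dt]; first exact: simple_pair.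
by apply: cvg_pair; [exact: sf|exact: rg].
Qed.

Lemma pw_measurableB X (D : set Omega) (f g : Omega -> X) :
  pw_measurable D f -> pw_measurable D g ->
  pw_measurable D (fun t => f t - g t).
Proof.
move=> mf mg; have := pw_measurable_pair mf mg.
move=> /(pw_measurable_comp (phi := fun x : X * X => x.1 - x.2)); apply.
by move=> x; apply: cvgB; [exact: cvg_fst|exact: cvg_snd].
Qed.

Lemma pw_measurable_fun (D : set Omega) (f : Omega -> R) :
  pw_measurable D f -> measurable_fun D f.
Proof.
move=> [s [ss sf]]; apply: (measurable_fun_cvg (h := s)) => // n mD A mA.
by apply: measurableI => //; exact: simple_preimage.
Qed.

Lemma pw_measurable_norm X (D : set Omega) (f : Omega -> X) :
  pw_measurable D f -> measurable_fun D (fun t => `|f t|).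
Proof.
move=> mf; apply: pw_measurable_fun.
exact: (pw_measurable_comp (@norm_continuous _ X)).
Qed.

Variable mu : {measure set Omega -> \bar R}.

(** On a measurable null set containing the points of divergence, both the
    function and its approximants are set to zero. *)
Lemma strongly_measurable_version X (D : set Omega) (f : Omega -> X) :
  strongly_measurable mu D f ->
  exists2 f0 : Omega -> X, pw_measurable D f0 & ae_eq mu D f f0.
Proof.
move=> [s [ss [N [mN muN sN]]]].
pose chi t (x : X) : X := if t \in N then 0 else x.
exists (fun t => chi t (f t)).
  exists (fun n t => chi t (s n t)); split=> [n|t Dt].
    have [fs ms] := ss n; split.
      apply: (@sub_finite_set _ _ (0 |` range (s n))).
        by move=> _ [t _ <-]; rewrite /chi; case: ifP; [left|right; exists t].
      by rewrite finite_setU; split => //; exact: finite_set1.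
    move=> x; rewrite (_ : _ @^-1` _ =
        (N `&` [set _ | 0 = x]) `|` (~` N `&` s n @^-1` [set x])).
      apply: measurableU; last first.
        by apply: measurableI; [exact: measurableC|exact: ms].
      by apply: measurableI => //; have [->|/eqP x0] := eqVneq 0 x;
        [rewrite (_ : [set _ | _] = setT) //; apply/seteqP; split
        |rewrite (_ : [set _ | _] = set0) //; apply/seteqP; split].
    apply/seteqP; rewrite /chi; split=> [t /=|t /= [] [Nt]].
    - by case: ifPn => [/set_mem Nt xE|/negP Nt <-];
        [left|right; split=> // /mem_set].
    - by rewrite mem_set.
    - by rewrite memNset.
  rewrite /chi; case: ifPn => [_|Nt]; first exact: cvg_cst.
  apply: contrapT => nf; move/negP: Nt; apply; apply/mem_set/sN => /=.
  by move=> /(_ Dt).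
exists N; split=> // t /= h; apply: contrapT => Nt; apply: h => _.
by rewrite /chi memNset.
Qed.

Lemma pw_strongly_measurable X (D : set Omega) (f : Omega -> X) :
  pw_measurable D f -> strongly_measurable mu D f.
Proof. by move=> [s [ss sf]]; exists s; split=> //; exact: aeW. Qed.

Import HBNNSimple.

(** The integral of a nonnegative function is a supremum over the measurable
    simple functions below it. Such a function below [f] is below [g] once it is
    set to zero on the exceptional set, and this keeps its integral. *)
Lemma ge0_ae_eq_integral_le (D : set Omega) (f g : Omega -> \bar R) :
  measurable D -> (forall x, D x -> 0 <= f x)%E ->
  (forall x, D x -> 0 <= g x)%E -> ae_eq mu D f g ->
  (\int[mu]_(x in D) f x <= \int[mu]_(x in D) g x)%E.
Proof.
move=> mD f0 g0 [N [mN muN fgN]].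
rewrite (ge0_integralE mu f0) (ge0_integralE mu g0).
apply/ge_ereal_sup => _ /= [h hf <-].
have mNC := measurableC mN.
apply: (@le_trans _ _ (sintegral mu (proj_nnsfun h mNC))).
  rewrite -!integralT_nnsfun le_eqVlt; apply/orP; left; apply/eqP.
  apply: ge0_ae_eq_integral => //.
  - exact/measurable_EFinP.
  - exact/measurable_EFinP.
  - by move=> x _; rewrite lee_fin; exact: fun_ge0.
  - by move=> x _; rewrite lee_fin; exact: fun_ge0.
  - exists N; split=> // x /= hx; apply: contrapT => Nx; apply: hx => _.
    by rewrite mindicE mem_set// mulr1.
apply: ereal_sup_ubound; exists (proj_nnsfun h mNC) => //= x.
have [Nx|Nx] := boolP (x \in ~` N); last first.
  rewrite mindicE (negbTE Nx) mulr0 patchE; case: ifPn => //.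
  by move=> /set_mem/g0.
rewrite mindicE Nx mulr1; apply: le_trans (hf x) _.
rewrite !patchE; case: ifPn => // /set_mem Dx.
move/set_mem in Nx; rewrite le_eqVlt; apply/orP; left; apply/eqP.
by apply: contrapT => fg; apply: Nx; apply: fgN => /= /(_ Dx).
Qed.

Lemma ae_eq_integral_nonmeasurable (D : set Omega) (f g : Omega -> \bar R) :
  measurable D -> ae_eq mu D f g ->
  (\int[mu]_(x in D) f x = \int[mu]_(x in D) g x)%E.
Proof.
move=> mD fg; rewrite integralE [RHS]integralE.
have /ae_eq_funeposneg[fgp fgn] := fg.
congr (_ - _)%E; apply/eqP; rewrite eq_le !ge0_ae_eq_integral_le//;
  exact: ae_eq_sym.
Qed.

End StrongMeasurability.

Import HBSimple.

(** The identity of the real line is a pointwise limit of simple functions; [f]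
    transports these. *)
Lemma continuous_pw_measurable (R : realType) (X : normedModType R)
    (D : set R) (f : R -> X) :
  measurable D -> continuous f -> pw_measurable D f.
Proof.
move=> mD cf.
have mid : measurable_fun D (@EFin R) by exact/measurable_EFinP.
have [s sP] := approximation_sfun mD mid.
apply: (pw_measurable_comp (phi := f) (f := @id R) cf).
exists (fun n => s n); split=> [n|t Dt].
  split; first exact: fimfunP.
  by move=> x; rewrite -[_ @^-1` _]setTI; exact: measurable_funP.
by have /fine_cvgP[_] := sP t Dt.
Qed.

(** * Volterra fixed points in the Bochner space *)

Section ExponentialWeight.
Context {R : realType}.
Local Notation mu := (@lebesgue_measure R).

Lemma is_derive_expR_scale (B lam x : R) :
  is_derive x (1 : R) (fun s => B * expR (lam * s)) (B * lam * expR (lam * x)).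
Proof.
apply: is_derive_eq; rewrite /GRing.scale /=; ring.
Qed.

(** In the weight exp(lam * s), integration from 0 gains a factor 1 / lam. *)
Lemma exponential_weight (m : R -> R) (B lam t : R) :
  0 < lam -> 0 <= t -> 0 <= B ->
  mu.-integrable `[0, t] (EFin \o m) -> (forall s, 0 <= m s) ->
  {ae mu, forall s, `[0, t]%classic s -> m s <= B * expR (lam * s)} ->
  \int[mu]_(s in `[0, t]) m s <= B / lam * expR (lam * t).
Proof.
move=> lam0 t0 B0 im m0 mB.
pose F s := B / lam * expR (lam * s).
pose f s := B * expR (lam * s).
have dF s : is_derive s (1 : R) F (f s).
  have := is_derive_expR_scale (B / lam) lam s.
  by rewrite divfK ?gt_eqF.
have cF : continuous F.
  by move=> s; apply/differentiable_continuous/derivable1_diffP; case: (dF s).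
have cf : continuous f.
  move=> s; apply/differentiable_continuous/derivable1_diffP.
  by case: (is_derive_expR_scale B lam s).
have F0 s : 0 <= F s by rewrite mulr_ge0 ?expR_ge0// divr_ge0// ltW.
have [t00|tn0] := eqVneq t 0.
  by rewrite {1}t00 set_itv1 Rintegral_set1 F0.
have tpos : 0 < t by rewrite lt_neqAle eq_sym tn0.
rewrite -/(F t).
have intf : (\int[mu]_(s in `[0%R, t]) (f s)%:E)%E = ((F t)%:E - (F 0%R)%:E)%E.
  apply: continuous_FTC2 => //.
  - by apply: continuous_subspaceT => s; exact: cf.
  - split.
    + by move=> s _; case: (dF s).
    + by apply: cvg_at_right_filter; exact: cF.
    + by apply: cvg_at_left_filter; exact: cF.
  - by move=> s _; rewrite derive1E; case: (dF s).
have -> : \int[mu]_(s in `[0, t]) m s =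
  fine (\int[mu]_(s in `[0%R, t]) (m s)%:E)%E by [].
rewrite -lee_fin fineK; last exact: integrable_fin_num.
apply: (@le_trans _ _ (\int[mu]_(s in `[0%R, t]) (f s)%:E)%E).
  apply: ae_ge0_le_integral => //.
  - by move=> s _; rewrite lee_fin.
  - exact: measurable_int im.
  - by move=> s _; rewrite lee_fin mulr_ge0// expR_ge0.
  - apply/measurable_EFinP; apply: measurable_funTS.
    exact: continuous_measurable_fun.
by rewrite intf -EFinB lee_fin gerBl.
Qed.

End ExponentialWeight.

Lemma geometric_le0 (R : realType) (y D : R) :
  (forall n, y <= D * 2^-1 ^+ n) -> y <= 0.
Proof.
move=> yD; have f0 : D * 2^-1 ^+ n @[n --> \oo] --> 0.
  by apply: cvg_geometric; rewrite ger0_norm ?invr_ge0// invf_lt1// ltr1n.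
by apply: (cvgr_to_ge f0); apply: nearW => n; exact: yD.
Qed.

Lemma geometric_tail (R : realType) (X : normedModType R) (u : nat -> X)
    (l : X) (A : R) :
  (forall n, `|u n.+1 - u n| <= A * 2^-1 ^+ n) -> u n @[n --> \oo] --> l ->
  forall n, `|l - u n| <= 2 * A * 2^-1 ^+ n.
Proof.
move=> uA ul n.
have A0 : 0 <= A by have := uA 0%N; rewrite expr0 mulr1; apply: le_trans.
have part k : `|u (k + n)%N - u n| <= 2 * A * 2^-1 ^+ n * (1 - 2^-1 ^+ k).
  elim: k => [|k IHk]; first by rewrite add0n subrr normr0 expr0 subrr mulr0.
  rewrite addSn -(subrK (u (k + n)%N) (u (k + n).+1)) -addrA.
  rewrite (le_trans (ler_normD _ _))//.
  apply: le_trans (lerD (uA _) IHk) _.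
  by rewrite exprD exprS le_eqVlt; apply/orP; left; apply/eqP; field.
have cn : `|u (k + n)%N - u n| @[k --> \oo] --> `|l - u n|.
  by apply: cvg_norm; apply: cvgB; [rewrite cvg_shiftn|exact: cvg_cst].
apply: (cvgr_to_le cn); apply: nearW => k; apply: le_trans (part k) _.
apply: ler_piMr; last by rewrite gerBl exprn_ge0// invr_ge0.
by rewrite !mulr_ge0// exprn_ge0// invr_ge0.
Qed.

Section Volterra.
Context {R : realType} {X : normedModType R} (T : R).
Hypothesis T_ge0 : 0 <= T.
Local Notation mu := (@lebesgue_measure R).
Local Notation aeF := (ae_filter_ringOfSetsType mu).
Local Notation J := (`[0, T]%classic : set R).

(** Representatives of the elements of the Bochner space on [0, T] for which
    every integral below is that of a measurable function. *)
Definition L1_fun (Y : normedModType R) (x : R -> Y) :=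
  pw_measurable J x /\ mu.-integrable J (EFin \o (fun t => `|x t|)).

Lemma L1_funB (x y : R -> X) :
  L1_fun x -> L1_fun y -> L1_fun (fun t => x t - y t).
Proof.
move=> [mx ix] [my iy]; split; first exact: pw_measurableB.
apply: (le_integrable _ _ _ (integrableD _ ix iy)) => //.
  apply/measurable_EFinP; apply: pw_measurable_norm; exact: pw_measurableB.
move=> t _ /=; rewrite lee_fin normr_id ger0_norm ?addr_ge0//.
exact: ler_normB.
Qed.

Lemma L1_funN (x : R -> X) : L1_fun x -> L1_fun (fun t => - x t).
Proof.
move=> [mx ix]; split; last first.
  rewrite (_ : (fun t => `|- x t|) = fun t => `|x t|)//.
  by apply/funext => t; rewrite normrN.
by apply: (pw_measurable_comp (phi := -%R)) mx; exact: opp_continuous.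
Qed.

Lemma L1_funD (x y : R -> X) :
  L1_fun x -> L1_fun y -> L1_fun (fun t => x t + y t).
Proof.
move=> Lx /L1_funN/(L1_funB Lx); congr L1_fun; apply/funext => t.
by rewrite opprK.
Qed.

Lemma L1_fun_continuous (y : R -> X) : continuous y -> L1_fun y.
Proof.
move=> cy; split; first exact: continuous_pw_measurable.
apply: continuous_compact_integrable; first exact: segment_compact.
by apply: continuous_subspaceT => t; apply: continuous_comp;
  [exact: cy|exact: norm_continuous].
Qed.

Lemma L1_fun_sub (x : R -> X) t : L1_fun x -> J t ->
  mu.-integrable `[0, t] (EFin \o (fun s => `|x s|)).
Proof.
move=> [_ ix]; rewrite /= in_itv/= => /andP[t0 tT].
apply: integrableS ix => //; apply: subset_itvl; by rewrite bnd_simp.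
Qed.

(** A Gronwall argument on the integral I(t) of the norm of the difference m: as
    m <= C * I almost everywhere, a bound I(t) <= B * exp(2 C t) improves itself
    to B / 2, and I(T) is a first such B. *)
Lemma volterra_unique (K : (R -> X) -> R -> X) (C : R) (h x y : R -> X) :
  0 < C ->
  (forall x y t, L1_fun x -> L1_fun y -> J t ->
    `|K x t - K y t| <= C * \int[mu]_(s in `[0, t]) `|x s - y s|) ->
  L1_fun x -> L1_fun y ->
  {ae mu, forall t, J t -> x t = h t + K x t} ->
  {ae mu, forall t, J t -> y t = h t + K y t} ->
  ae_eq mu J x y.
Proof.
move=> C0 Klip Lx Ly hx hy.
pose m t := `|x t - y t|.
pose I t := \int[mu]_(s in `[0, t]) m s.
have im t : J t -> mu.-integrable `[0, t] (EFin \o m).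
  by move=> Jt; exact: L1_fun_sub (L1_funB Lx Ly) Jt.
have mI : {ae mu, forall t, J t -> m t <= C * I t}.
  apply: (@filterS2 _ _ aeF) hx hy => t hx hy Jt.
  rewrite /m (hx Jt) (hy Jt) opprD addrACA subrr add0r.
  exact: Klip.
have m0 s : 0 <= m s by exact: normr_ge0.
have I0 t : 0 <= I t by apply: Rintegral_ge0 => s _; exact: normr_ge0.
have JT : J T by rewrite /= in_itv/= T_ge0 lexx.
have IT t : J t -> I t <= I T.
  move=> Jt; rewrite -lee_fin /I /Rintegral !fineK; last 2 first.
  - exact: integrable_fin_num (im _ JT).
  - exact: integrable_fin_num (im _ Jt).
  apply: ge0_subset_integral => //.
  - exact: measurable_int (im _ JT).
  - by move=> s _; rewrite lee_fin.
  - by move: Jt; rewrite /= in_itv/= => /andP[_ tT]; apply: subset_itvl.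
have Iexp n t : J t -> I t <= I T * 2^-1 ^+ n * expR (2 * C * t).
  elim: n t => [|n IHn] t Jt.
    rewrite expr0 mulr1 (le_trans (IT _ Jt))// ler_peMr//.
    rewrite -expR0 ler_expR mulr_ge0//; first by rewrite mulr_ge0// ltW.
    by move: Jt; rewrite /= in_itv/= => /andP[].
  have /andP[t0 tT] : 0 <= t <= T by move: Jt; rewrite /= in_itv.
  have := @exponential_weight R m (C * (I T * 2^-1 ^+ n)) (2 * C) t.
  have -> : C * (I T * 2^-1 ^+ n) / (2 * C) = I T * 2^-1 ^+ n.+1.
    by rewrite exprSr; field; rewrite gt_eqF.
  apply => //.
  - by rewrite mulr_gt0.
  - by apply: mulr_ge0; [exact: ltW|];
      apply: mulr_ge0; rewrite ?exprn_ge0 ?invr_ge0.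
  - exact: im.
  - apply: (@filterS _ _ aeF) mI => s mI /=; rewrite in_itv/= => /andP[s0 st].
    have Js : J s by rewrite /= in_itv/= s0 (le_trans st).
    by rewrite (le_trans (mI Js))// -mulrA ler_pM2l// IHn.
have I00 t : J t -> I t = 0.
  move=> Jt; apply/eqP; rewrite eq_le I0 andbT.
  apply: (@geometric_le0 _ _ (I T * expR (2 * C * t))) => n.
  by rewrite mulrAC; exact: Iexp.
apply: (@filterS _ _ aeF) mI => t mI Jt; apply/subr0_eq/eqP; rewrite -normr_eq0.
by rewrite eq_le normr_ge0 andbT; have := mI Jt; rewrite I00// mulr0.
Qed.

(** Picard iteration from [h]. The iterates are only integrable, but they differ
    from [h] by continuous functions, and these converge uniformly: in the
    weight exp(2 C t) each step is at most half of the previous one. *)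
Lemma volterra_exists (K : (R -> X) -> R -> X) (C : R) (h : R -> X) :
  (forall (u : nat -> X) (A : R),
    (forall n, `|u n.+1 - u n| <= A * 2^-1 ^+ n) ->
    exists l : X, u n @[n --> \oo] --> l) ->
  0 < C ->
  (forall x, L1_fun x -> continuous (K x)) ->
  (forall x y t, L1_fun x -> L1_fun y -> J t ->
    `|K x t - K y t| <= C * \int[mu]_(s in `[0, t]) `|x s - y s|) ->
  L1_fun h ->
  exists2 x, L1_fun x & forall t, J t -> x t = h t + K x t.
Proof.
move=> Xcvg C0 Kcont Klip Lh.
(* Clipping makes the differences continuous on the whole line, with the same
   geometric bounds. *)
pose clip t : R := Order.max 0 (Order.min t T).
have clipJ t : J (clip t).
  by rewrite /= in_itv/= le_max lexx/= ge_max T_ge0 ge_min lexx orbT.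
have clipE t : J t -> clip t = t.
  by rewrite /= in_itv/= => /andP[t0 tT]; rewrite /clip min_l// max_r.
have clip_cont : continuous clip.
  move=> t; apply: (@continuous_max _ _ (cst 0) (fun s => Order.min s T)).
    exact: cst_continuous.
  apply: (@continuous_min _ _ id (cst T)); first exact: cvg_id.
  exact: cst_continuous.
pose xs n := iter n (fun x t => h t + K x (clip t)) h.
pose z n t := K (xs n) (clip t).
have zcont n : L1_fun (xs n) -> continuous (z n).
  move=> Lx t; apply: continuous_comp; first exact: clip_cont.
  exact: Kcont.
have Lxs n : L1_fun (xs n).
  elim: n => [//|n IHn]; rewrite /xs iterS -/(xs n).
  by apply: L1_funD => //; apply: L1_fun_continuous; exact: zcont.
have xsS n t : xs n.+1 t = h t + z n t by [].
have [A Abnd] : exists A, forall t, J t -> `|K h t| <= A.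
  have cn : {within J, continuous (fun t => `|K h t|)}.
    apply: continuous_subspaceT => t; apply: continuous_comp.
      exact: Kcont.
    exact: norm_continuous.
  have [c _ cP] := EVT_max T_ge0 cn.
  by exists `|K h c| => t Jt; exact: cP.
have A0 : 0 <= A by apply: le_trans (Abnd 0 _) => //=; rewrite in_itv/= lexx.
have step n t : J t ->
    `|xs n.+1 t - xs n t| <= A * 2^-1 ^+ n * expR (2 * C * t).
  elim: n t => [|n IHn] t Jt; have /andP[t0 tT] : 0 <= t <= T
      by move: Jt; rewrite /= in_itv.
    rewrite xsS addrC addKr /z clipE// expr0 mulr1 (le_trans (Abnd _ Jt))//.
    by rewrite ler_peMr// -expR0 ler_expR !mulr_ge0// ltW.
  rewrite !xsS opprD addrACA subrr add0r /z clipE//.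
  apply: le_trans (Klip _ _ _ (Lxs n.+1) (Lxs n) Jt) _.
  have -> : A * 2^-1 ^+ n.+1 * expR (2 * C * t) =
      C * (A * 2^-1 ^+ n / (2 * C) * expR (2 * C * t)).
    by rewrite exprSr; field; rewrite gt_eqF.
  rewrite ler_pM2l//; apply: exponential_weight => //.
  - by rewrite mulr_gt0.
  - by rewrite mulr_ge0// exprn_ge0// invr_ge0.
  - exact: L1_fun_sub (L1_funB (Lxs n.+1) (Lxs n)) Jt.
  - apply: aeW => s /=; rewrite in_itv/= => /andP[s0 st]; apply: IHn.
    by rewrite /= in_itv/= s0 (le_trans st).
pose A' := A * expR (2 * C * T).
have A'0 : 0 <= A' by rewrite mulr_ge0// expR_ge0.
have zstep t n : `|z n.+1 t - z n t| <= A' * 2^-1 ^+ n.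
  have -> : z n.+1 t - z n t = xs n.+2 (clip t) - xs n.+1 (clip t).
    by rewrite !xsS opprD addrACA subrr add0r /z (clipE _ (clipJ t)).
  apply: le_trans (step _ _ (clipJ t)) _.
  rewrite /A' [leRHS]mulrAC; apply: ler_pM.
  - by rewrite mulr_ge0// exprn_ge0// invr_ge0.
  - exact: expR_ge0.
  - rewrite ler_wpM2l// exprS.
    by rewrite ler_piMl ?exprn_ge0 ?invr_ge0// invf_le1// ler1n.
  - rewrite ler_expR ler_wpM2l//; first by rewrite mulr_ge0// ltW.
    by have := clipJ t; rewrite /= in_itv/= => /andP[].
have /choice[zl zlP] t : exists l : X, z n t @[n --> \oo] --> l.
  exact: Xcvg (zstep t).
have ztail n t : `|zl t - z n t| <= 2 * A' * 2^-1 ^+ n.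
  exact: (geometric_tail (u := z^~ t)).
have zlcont : continuous zl.
  move=> t; apply/cvgrPdist_lt => e e0.
  have e3 : 0 < e / 3 by rewrite divr_gt0.
  have [n nP] : exists n, 2 * A' * 2^-1 ^+ n < e / 3.
    apply: contrapT => /forallNP hn.
    suff : e / 3 <= 0 by rewrite leNgt e3.
    by apply: geometric_le0 => n; have /negP := hn n; rewrite -leNgt; exact.
  have /cvgrPdist_lt/(_ _ e3) := zcont n (Lxs n) t.
  apply: filterS => s hs.
  have -> : zl t - zl s = (zl t - z n t) + (z n t - z n s) - (zl s - z n s).
    by rewrite (addrA _ (z n t)) subrK opprB addrA subrK.
  rewrite (le_lt_trans (ler_normB _ _))// (_ : e = e / 3 + e / 3 + e / 3).
    rewrite ltrD//; last exact: le_lt_trans (ztail _ _) nP.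
    rewrite (le_lt_trans (ler_normD _ _))// ltrD//.
    exact: le_lt_trans (ztail _ _) nP.
  by field.
exists (fun t => h t + zl t).
  by apply: L1_funD => //; exact: L1_fun_continuous.
move=> t Jt; congr (_ + _).
have /andP[t0 tT] : 0 <= t <= T by move: Jt; rewrite /= in_itv.
set x := fun t => h t + zl t.
have Lx : L1_fun x by apply: L1_funD => //; exact: L1_fun_continuous.
apply/subr0_eq/eqP; rewrite -normr_eq0 eq_le normr_ge0 andbT.
apply: (@geometric_le0 _ _ (A' + C * (2 * A' * T))) => n.
have -> : zl t - K x t = (zl t - z n.+1 t) + (K (xs n.+1) t - K x t).
  by rewrite /z clipE// addrA subrK.
rewrite (le_trans (ler_normD _ _))// mulrDl lerD//.
  apply: le_trans (ztail _ _) _; rewrite exprS.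
  by rewrite le_eqVlt; apply/orP; left; apply/eqP; field.
rewrite distrC; apply: le_trans (Klip _ _ _ Lx (Lxs n.+1) Jt) _.
rewrite -mulrA ler_pM2l//.
have cst0 : 0 <= 2 * A' * 2^-1 ^+ n.
  by rewrite !mulr_ge0// exprn_ge0// invr_ge0.
apply: (@le_trans _ _ (\int[mu]_(s in `[0, t]) (2 * A' * 2^-1 ^+ n))).
  apply: le_Rintegral => //.
  - exact: L1_fun_sub (L1_funB Lx (Lxs n.+1)) Jt.
  - apply: continuous_compact_integrable; first exact: segment_compact.
    by apply: continuous_subspaceT => s; exact: cvg_cst.
  - by move=> s _; rewrite /x xsS opprD addrACA subrr add0r.
rewrite Rintegral_cst//= lebesgue_measure_itv/= lte_fin.
case: ifP => _ /=; last by rewrite mulr0 !mulr_ge0// ?exprn_ge0 ?invr_ge0.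
by rewrite subr0 mulrAC ler_wpM2r ?exprn_ge0 ?invr_ge0// ler_wpM2l ?mulr_ge0.
Qed.

End Volterra.

(** * Memory terms with a continuous kernel *)

Lemma continuous_within_comp (S U W : topologicalType) (A : set U)
    (f : U -> W) (g : S -> U) :
  {within A, continuous f} -> continuous g -> (forall x, A (g x)) ->
  continuous (f \o g).
Proof.
move=> /subspace_continuousP cf cg gA x.
apply: cvg_comp (cf _ (gA x)) => P /= AP.
have AP' : \forall y \near x, A (g y) -> P (g y) := cg x _ AP.
by apply: (@filterS _ (nbhs x) _ _ _ _ AP') => y; apply; exact: gA.
Qed.

Lemma cvg_along_sequences (R : realType) (f : R -> R) (p l : R) :
  (forall u : nat -> R, u n @[n --> \oo] --> p -> f (u n) @[n --> \oo] --> l) ->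
  f x @[x --> p] --> l.
Proof.
move=> fu; apply/cvgrPdist_lt => e e0; apply: contrapT => nf.
have /choice[u uP] n : exists x, `|p - x| < n.+1%:R^-1 /\ ~ `|l - f x| < e.
  apply: contrapT => /forallNP hn; apply: nf.
  have n0 : 0 < n.+1%:R^-1 :> R by rewrite invr_gt0.
  apply/nbhs_ballP; exists n.+1%:R^-1 => //= x px; apply: contrapT => lx.
  by apply: (hn x); split.
have up : u n @[n --> \oo] --> p.
  apply/cvgrPdist_lt => d d0.
  have /cvgrPdist_lt/(_ _ d0) := @cvg_harmonic R.
  apply: filterS => n /=; rewrite sub0r normrN ger0_norm//.
  by apply: lt_trans; case: (uP n).
have /cvgrPdist_lt/(_ _ e0) [N _ /(_ N (leqnn N))] := fu u up.
by case: (uP N).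
Qed.

Section Kernel.
Context {R : realType} (T : R).
Hypothesis T_ge0 : 0 <= T.
Local Notation mu := (@lebesgue_measure R).
Local Notation aeF := (ae_filter_ringOfSetsType mu).
Local Notation J := (`[0, T]%classic : set R).

(** Composing with this map extends a kernel from the triangle to a continuous
    function on the plane; times outside [0, T] are moved to the nearest
    endpoint. *)
Definition triangle_retraction (x : R * R) : R * R :=
  let t := Order.max 0 (Order.min x.1 T) in
  (t, Order.max 0 (Order.min x.2 t)).

(** The indicator turns an integral over [0, t] into one over the fixed interval
    [0, T], so that the dependence on t is in the integrand only. *)
Definition cutoff_kernel (k : R -> R -> R) (t s : R) : R :=
  let x := triangle_retraction (t, s) in k x.1 x.2 * \1_`]-oo, t] s.

Lemma triangle_retractionP x : triangle T (triangle_retraction x).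
Proof.
rewrite /triangle /triangle_retraction /=; split; last split.
- by rewrite le_max lexx.
- by rewrite ge_max le_max lexx/= ge_min lexx orbT.
- by rewrite ge_max T_ge0 ge_min lexx orbT.
Qed.

Lemma triangle_retractionE x : triangle T x -> triangle_retraction x = x.
Proof.
case: x => t s; rewrite /triangle /triangle_retraction /= => -[s0 [st tT]].
have t0 := le_trans s0 st.
by rewrite (min_l tT) (max_r t0) (min_l st) (max_r s0).
Qed.

Lemma triangle_retraction_continuous : continuous triangle_retraction.
Proof.
have c1 : continuous (fun x : R * R => Order.max 0 (Order.min x.1 T)).
  move=> x; apply: (@continuous_max _ _ (cst 0) (fun x => Order.min x.1 T)).
    exact: cst_continuous.
  apply: (@continuous_min _ _ fst (cst T)); first exact: cvg_fst.
  exact: cst_continuous.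
have c2 : continuous (fun x : R * R =>
    Order.max 0 (Order.min x.2 (Order.max 0 (Order.min x.1 T)))).
  move=> x; apply: (@continuous_max _ _ (cst 0) (fun x => Order.min x.2
    (Order.max 0 (Order.min x.1 T)))); first exact: cst_continuous.
  apply: (@continuous_min _ _ snd (fun x => Order.max 0 (Order.min x.1 T))).
    exact: cvg_snd.
  exact: c1.
by move=> x; exact: (cvg_pair (c1 x) (c2 x)).
Qed.

Section OneKernel.
Variables (k : R -> R -> R) (C : R).
Hypothesis kP : volterra_kernel T k C.
Local Notation kappa := (cutoff_kernel k).

Let kr t s := k (triangle_retraction (t, s)).1 (triangle_retraction (t, s)).2.

Let kr_continuous : continuous (fun x => kr x.1 x.2).
Proof.
have [ck _] := kP.
rewrite (_ : (fun x => _) = (fun x => k x.1 x.2) \o triangle_retraction).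
  exact: continuous_within_comp ck triangle_retraction_continuous
    triangle_retractionP.
by apply/funext => -[].
Qed.

Let kr_continuous_l s : continuous (kr^~ s).
Proof.
move=> t; have ts : (fun r : R => (r, s)) @ t --> (t, s).
  exact: (cvg_pair (@cvg_id _ _) (cvg_cst s)).
apply: (@continuous_comp _ _ _ (fun t => (t, s)) (fun x => kr x.1 x.2)).
  exact: ts.
exact: kr_continuous.
Qed.

Let kr_continuous_r t : continuous (kr t).
Proof.
move=> s; have ts : (fun r : R => (t, r)) @ s --> (t, s).
  exact: (cvg_pair (cvg_cst t) (@cvg_id _ _)).
apply: (@continuous_comp _ _ _ (fun s => (t, s)) (fun x => kr x.1 x.2)).
  exact: ts.
exact: kr_continuous.
Qed.

Lemma kernel_bound_ge0 : 0 <= C.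
Proof.
by have [_ kC] := kP; apply: le_trans (kC 0 0 _).
Qed.

Lemma cutoff_kernel_bounded t s : `|kappa t s| <= C * \1_`]-oo, t] s.
Proof.
have [_ kC] := kP; rewrite /cutoff_kernel /= normrM [X in _ * X]ger0_norm//.
rewrite ler_wpM2r//; apply: kC.
exact: (triangle_retractionP (t, s)).
Qed.

Lemma cutoff_kernel_diff t t' s : `|kappa t s - kappa t' s| <= C + C.
Proof.
have bnd r : `|kappa r s| <= C.
  apply: le_trans (cutoff_kernel_bounded r s) _.
  apply: ler_piMr; first exact: kernel_bound_ge0.
  by rewrite indicE; case: (_ \in _); rewrite ?lexx ?ler01.
by rewrite (le_trans (ler_normB _ _))// lerD.
Qed.

Lemma cutoff_kernel_measurable t D : measurable D -> measurable_fun D (kappa t).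
Proof.
move=> mD; apply: measurable_funM; last exact: measurable_indic.
apply: measurable_funTS; apply: continuous_measurable_fun => s.
exact: kr_continuous_r.
Qed.

(** The cutoff is the only discontinuity in t, and it is at t = s. *)
Lemma cutoff_kernel_cvg (u : nat -> R) t s : s != t ->
  u n @[n --> \oo] --> t -> kappa (u n) s @[n --> \oo] --> kappa t s.
Proof.
move=> st ut.
have krc : kr (u n) s @[n --> \oo] --> kr t s.
  apply: (@cvg_comp _ _ _ u (kr^~ s) _ _ _ ut).
  exact: kr_continuous_l.
apply: cvgM => //.
apply: cvg_near_cst.
move: st; rewrite neq_lt => /orP[st|ts].
  have sun : \forall n \near \oo, s < u n by exact: (cvgr_gt _ ut).
  apply: filterS sun => n sn.
  by rewrite !indicE !mem_set//= in_itv/= ltW.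
have sun : \forall n \near \oo, u n < s by exact: (cvgr_lt _ ut).
apply: filterS sun => n sn.
by rewrite !indicE !memNset//= in_itv/= leNgt; apply/negP; rewrite negbK.
Qed.

Lemma cutoff_kernelE t s : J t -> `[0, t]%classic s -> kappa t s = k t s.
Proof.
rewrite /= !in_itv/= => /andP[t0 tT] /andP[s0 st].
rewrite /cutoff_kernel triangle_retractionE; last by rewrite /triangle.
by rewrite indicE mem_set ?mulr1//= in_itv.
Qed.

Lemma cutoff_kernel0 t s : t < s -> kappa t s = 0.
Proof.
move=> ts; rewrite /cutoff_kernel indicE memNset ?mulr0//= in_itv/= leNgt.
by rewrite ts.
Qed.

Lemma Rintegral_cutoff (F G : R -> R) t : J t ->
  (forall s, `[0, t]%classic s -> F s = G s) -> (forall s, t < s -> G s = 0) ->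
  \int[mu]_(s in `[0, t]) F s = \int[mu]_(s in J) G s.
Proof.
move=> /=; rewrite in_itv/= => /andP[t0 tT] FG G0.
rewrite (_ : `[0, t]%classic = J `&` `]-oo, t]); last first.
  apply/seteqP; split=> s /=; rewrite !in_itv/=.
    by move=> /andP[s0 st]; rewrite s0 st (le_trans st).
  by move=> [/andP[-> _] ->].
rewrite Rintegral_mkcondr; apply: eq_Rintegral => s /set_mem Js.
rewrite patchE; case: ifPn => [/set_mem st|].
  by apply: FG; move: Js st; rewrite /= !in_itv/= => /andP[-> _] ->.
by rewrite notin_setE /= in_itv/= => /negP; rewrite -ltNge => /G0.
Qed.

Context {X : normedModType R}.

(** It bounds the variation in time of every memory term built from [k] and
    [x], uniformly in the test vector. *)
Definition kernel_modulus (x : R -> X) t0 t :=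
  \int[mu]_(s in J) (`|kappa t0 s - kappa t s| * `|x s|).

Lemma kernel_modulus_integrable (x : R -> X) t0 t : L1_fun T x ->
  mu.-integrable J (EFin \o (fun s => `|kappa t0 s - kappa t s| * `|x s|)).
Proof.
move=> [mx ix]; have : mu.-integrable J (fun s => (C + C)%:E * (`|x s|)%:E)%E.
  exact: integrableZl.
apply: le_integrable => //.
  apply/measurable_EFinP; apply: measurable_funM.
    apply: measurableT_comp => //.
    by apply: measurable_funB; exact: cutoff_kernel_measurable.
  exact: pw_measurable_norm.
move=> s _ /=; rewrite lee_fin !normrM !normr_id ler_wpM2r//.
rewrite [leRHS]ger0_norm ?addr_ge0 ?kernel_bound_ge0//.
exact: cutoff_kernel_diff.
Qed.

(** Dominated convergence: for fixed s the integrand tends to 0 unless s = t0. *)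
Lemma kernel_modulus_cvg (x : R -> X) t0 : L1_fun T x ->
  kernel_modulus x t0 t @[t --> t0] --> 0.
Proof.
move=> Lx; have [mx ix] := Lx; apply: cvg_along_sequences => u ut0.
pose f n s := (`|kappa t0 s - kappa (u n) s| * `|x s|)%:E.
have mf n : measurable_fun J (f n).
  exact: measurable_int (kernel_modulus_integrable t0 (u n) Lx).
have ig : mu.-integrable J (fun s => (C + C)%:E * (`|x s|)%:E)%E.
  exact: integrableZl.
have f0 : \forall s \ae mu, J s -> f n s @[n --> \oo] --> 0%E.
  have : mu.-negligible [set t0].
    by apply/negligibleP => //; exact: lebesgue_measure_set1.
  apply: negligibleS => s /= h; apply: contrapT => /eqP st; apply: h => _.
  rewrite /f; apply: cvg_EFin; first exact: nearW.
  rewrite -[X in _ --> X](mul0r `|x s|).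
  apply: cvgMl; rewrite -(normr0 R) -(subrr (kappa t0 s)).
  by apply: cvg_norm; apply: cvgB; [exact: cvg_cst|exact: cutoff_kernel_cvg].
have fg : \forall s \ae mu, forall n, J s ->
    (`|f n s| <= ((C + C) * `|x s|)%:E)%E.
  apply: aeW => s n _; rewrite /f lee_fin normrM !normr_id ler_wpM2r//.
  exact: cutoff_kernel_diff.
have [||_ _] :=
  @dominated_convergence _ _ _ mu J _ f (cst 0%E) _ mf _ f0 ig fg => //.
rewrite integral0 => /fine_cvgP[_]; exact.
Qed.

End OneKernel.
End Kernel.

Section KernelIntegral.
Context {R : realType} (T : R).
Hypothesis T_ge0 : 0 <= T.
Local Notation mu := (@lebesgue_measure R).
Local Notation J := (`[0, T]%classic : set R).
Context {X Y : normedModType R}.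
Variables (k : R -> R -> R) (C : R) (c : X -> Y -> R) (M : R).
Hypothesis kP : volterra_kernel T k C.
Hypothesis M_ge0 : 0 <= M.
Hypothesis c_linear_l : forall r x x' y, c (r *: x + x') y = r * c x y + c x' y.
Hypothesis c_linear_r : forall r x y y', c x (r *: y + y') = r * c x y + c x y'.
Hypothesis c_bounded : forall x y, `|c x y| <= M * `|x| * `|y|.
Local Notation kappa := (cutoff_kernel T k).

(** The weak form of a memory term: a functional of the test vector [y]. *)
Definition kernel_integral (x : R -> X) t y :=
  \int[mu]_(s in J) (kappa t s * c (x s) y).

Let C_ge0 : 0 <= C := kernel_bound_ge0 T_ge0 kP.

Let cB x x' y : c (x - x') y = c x y - c x' y.
Proof.
by rewrite (_ : x - x' = (-1) *: x' + x) ?c_linear_l ?scaleN1r 1?addrC//; ring.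
Qed.

Lemma form_measurable (x : R -> X) y : pw_measurable J x ->
  measurable_fun J (fun s => c (x s) y).
Proof.
move=> mx; apply: pw_measurable_fun.
apply: (pw_measurable_comp (phi := c^~ y)) mx.
apply: bounded_functional_continuous; split=> [r u v|]; first exact: c_linear_l.
by exists (M * `|y|) => u; rewrite mulrAC.
Qed.

(** The three weights [W] used are a constant, for boundedness, a multiple of the
    indicator of s <= t, for the Volterra estimate, and the variation of the
    kernel between two times, for continuity. *)
Lemma form_integral_le (th W : R -> R) (w : R -> X) y :
  pw_measurable J w -> measurable_fun J th -> (forall s, `|th s| <= W s) ->
  mu.-integrable J (EFin \o (fun s => W s * `|w s|)) ->
  mu.-integrable J (EFin \o (fun s => th s * c (w s) y)) /\
  `|\int[mu]_(s in J) (th s * c (w s) y)| <=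
    M * \int[mu]_(s in J) (W s * `|w s|) * `|y|.
Proof.
move=> mw mth thW iW.
have le s : `|th s * c (w s) y| <= M * `|y| * (W s * `|w s|).
  rewrite normrM mulrC (_ : M * `|y| * (W s * `|w s|) =
    (M * `|w s| * `|y|) * W s); last by ring.
  exact: ler_pM.
have iMW : mu.-integrable J (EFin \o (fun s => M * `|y| * (W s * `|w s|))).
  have : mu.-integrable J (fun s => (M * `|y|)%:E * (W s * `|w s|)%:E)%E.
    exact: integrableZl.
  by apply: eq_integrable.
have ith : mu.-integrable J (EFin \o (fun s => th s * c (w s) y)).
  apply: le_integrable iMW => //.
    apply/measurable_EFinP; apply: measurable_funM => //.
    exact: form_measurable.
  by move=> s _; rewrite /= lee_fin (le_trans (le s))// ler_norm.
split=> //; apply: le_trans (le_normr_Rintegral _ ith) _ => //.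
rewrite (_ : M * _ * _ = \int[mu]_(s in J) (M * `|y| * (W s * `|w s|))).
  by apply: le_Rintegral => //; exact: integrable_norm ith.
by rewrite RintegralZl//; ring.
Qed.

Let kappa_bounded t s : `|kappa t s| <= C.
Proof.
apply: le_trans (cutoff_kernel_bounded T_ge0 kP t s) _.
by apply: ler_piMr => //; rewrite indicE; case: (_ \in _); rewrite ?lexx ?ler01.
Qed.

Let kappa_measurable t : measurable_fun J (kappa t).
Proof. exact: (cutoff_kernel_measurable T_ge0 kP). Qed.

Let integrable_Cnorm (x : R -> X) : L1_fun T x ->
  mu.-integrable J (EFin \o (fun s => C * `|x s|)).
Proof.
move=> [mx ix]; have : mu.-integrable J (fun s => C%:E * (`|x s|)%:E)%E.
  exact: integrableZl.
by apply: eq_integrable.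
Qed.

Lemma kernel_integrable (x : R -> X) t y : L1_fun T x ->
  mu.-integrable J (EFin \o (fun s => kappa t s * c (x s) y)).
Proof.
move=> Lx; have [mx _] := Lx.
by have [] := form_integral_le y mx (kappa_measurable t) (kappa_bounded t)
  (integrable_Cnorm Lx).
Qed.

Lemma kernel_integral_functional (x : R -> X) t : L1_fun T x ->
  bounded_functional (kernel_integral x t).
Proof.
move=> Lx; have [mx _] := Lx; split=> [r y y'|].
  rewrite /kernel_integral -RintegralZl//; last exact: kernel_integrable.
  rewrite -RintegralD//; last exact: kernel_integrable.
    by apply: eq_Rintegral => s _; rewrite c_linear_r; ring.
  have : mu.-integrable J (fun s => r%:E * (kappa t s * c (x s) y)%:E)%E.
    by apply: integrableZl => //; exact: kernel_integrable.
  by apply: eq_integrable.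
exists (M * \int[mu]_(s in J) (C * `|x s|)) => y.
by have [] := form_integral_le y mx (kappa_measurable t) (kappa_bounded t)
  (integrable_Cnorm Lx).
Qed.

Lemma kernel_integral_lipschitz (x x' : R -> X) t y :
  L1_fun T x -> L1_fun T x' -> J t ->
  `|kernel_integral x t y - kernel_integral x' t y| <=
  M * C * \int[mu]_(s in `[0, t]) `|x s - x' s| * `|y|.
Proof.
move=> Lx Lx' Jt; have Lw := L1_funB Lx Lx'; have [mw iw] := Lw.
rewrite /kernel_integral -RintegralB//; [|exact: kernel_integrable..].
rewrite (_ : \int[mu]_(s in J) _ =
    \int[mu]_(s in J) (kappa t s * c (x s - x' s) y)); last first.
  by apply: eq_Rintegral => s _; rewrite cB; ring.
have iW : mu.-integrable J
    (EFin \o (fun s => C * \1_`]-oo, t] s * `|x s - x' s|)).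
  apply: le_integrable (integrable_Cnorm Lw) => //.
    apply/measurable_EFinP; apply: measurable_funM.
      by apply: measurable_funM => //; exact: measurable_indic.
    exact: pw_measurable_norm.
  move=> s _ /=; rewrite lee_fin !normrM normr_id ler_wpM2r//.
  by apply: ler_piMr => //; rewrite indicE; case: (_ \in _);
    rewrite ?normr1 ?normr0 ?lexx ?ler01.
have [_ /le_trans] := form_integral_le y mw (kappa_measurable t)
  (cutoff_kernel_bounded T_ge0 kP t) iW.
apply; rewrite ler_wpM2r// -mulrA ler_wpM2l//.
rewrite -RintegralZl//; last exact: L1_fun_sub Lw Jt.
rewrite (@Rintegral_cutoff _ T (fun s => C * `|x s - x' s|)
  (fun s => C * \1_`]-oo, t] s * `|x s - x' s|) t Jt)//.
  move=> s /=; rewrite in_itv/= => /andP[_ st].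
  by rewrite indicE mem_set ?mulr1//= in_itv.
move=> s ts; rewrite indicE memNset ?mulr0 ?mul0r//= in_itv/= leNgt.
by rewrite ts.
Qed.

Lemma kernel_integral_continuous (x : R -> X) t t' y : L1_fun T x ->
  `|kernel_integral x t y - kernel_integral x t' y| <=
  M * kernel_modulus T k x t t' * `|y|.
Proof.
move=> Lx; have [mx _] := Lx.
rewrite /kernel_integral -RintegralB//; [|exact: kernel_integrable..].
rewrite (_ : \int[mu]_(s in J) _ =
    \int[mu]_(s in J) ((kappa t s - kappa t' s) * c (x s) y)); last first.
  by apply: eq_Rintegral => s _; ring.
have mth : measurable_fun J (fun s => kappa t s - kappa t' s).
  exact: measurable_funB.
have [] := form_integral_le y mx mth (fun s => lexx _)
  (kernel_modulus_integrable T_ge0 kP t t' Lx).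
by [].
Qed.

End KernelIntegral.

(** * Representatives and dual norms *)

Section BochnerRepresentatives.
Context {R : realType} (T : R).
Local Notation mu := (@lebesgue_measure R).
Local Notation aeF := (ae_filter_ringOfSetsType mu).
Local Notation J := (`[0, T]%classic : set R).

Lemma bochner_version (X : normedModType R) (f : R -> X) :
  bochner_L1 mu J f -> exists2 f0, L1_fun T f0 & ae_eq mu J f f0.
Proof.
move=> [/strongly_measurable_version[f0 mf0 ff0] fin].
exists f0 => //; split=> //; apply/integrableP; split.
  by apply/measurable_EFinP; exact: pw_measurable_norm.
rewrite (@ae_eq_integral_nonmeasurable _ _ _ mu J _ (fun t => (`|f t|)%:E)) //.
  by move: ff0; apply: (@filterS _ _ aeF) => t /= E Jt; rewrite E// normr_id.
Qed.

Lemma L1_fun_bochner (X : normedModType R) (f : R -> X) :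
  L1_fun T f -> bochner_L1 mu J f.
Proof.
move=> [mf /integrableP[_ fin]]; split; first exact: pw_strongly_measurable.
by under eq_integral do rewrite -normr_id.
Qed.

End BochnerRepresentatives.

Lemma prod_geometric_cvg (R : realType) (V Q : completeNormedModType R)
    (u : nat -> V * Q) (A : R) :
  (forall n, `|u n.+1 - u n| <= A * 2^-1 ^+ n) ->
  exists l : V * Q, u n @[n --> \oo] --> l.
Proof.
move=> uA.
have [l1 ul1] : exists l : V, (u n).1 @[n --> \oo] --> l.
  apply: (@geometric_cvg R V (fun n => (u n).1) A) => n; apply: le_trans (uA n).
  by rewrite [leRHS]prod_normE le_max lexx.
have [l2 ul2] : exists l : Q, (u n).2 @[n --> \oo] --> l.
  apply: (@geometric_cvg R Q (fun n => (u n).2) A) => n; apply: le_trans (uA n).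
  by rewrite [leRHS]prod_normE le_max lexx orbT.
exists (l1, l2); rewrite (_ : u = fun n => ((u n).1, (u n).2)).
  exact: cvg_pair.
by apply/funext => n; case: (u n).
Qed.

Lemma dual_norm_bound (R : realType) (X : normedModType R) (phi : dual X) x :
  `|phi x| <= `|phi| * `|x|.
Proof.
have [->|x0] := eqVneq x 0; first by rewrite linear0 !normr0 mulr0.
have nx : 0 < `|x| by rewrite normr_gt0.
rewrite -ler_pdivrMr//.
have := @dual_norm_ub R X phi (`|x|^-1 *: x).
rewrite normrZ normfV normr_id mulVf ?gt_eqF// lexx => /(_ isT).
by rewrite linearZ /= normrM normfV normr_id mulrC.
Qed.

Lemma dual_bounded_functional (R : realType) (X : normedModType R)
  (phi : dual X) : bounded_functional phi.
Proof.
split; first exact: dual_linear.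
by exists `|phi| => x; exact: dual_norm_bound.
Qed.

(** * The time-dependent saddle-point problem *)

Section SaddleVolterra.
Context {R : realType} {V Q : hilbertType R} (T : R).
Variables (k1 k2 k3 : R -> R -> R) (C1 C2 C3 : R).
Variables (a : {bilinear V -> V -> R}) (b : {bilinear V -> Q -> R}).
Hypothesis T_ge0 : 0 <= T.
Hypothesis k1P : volterra_kernel T k1 C1.
Hypothesis k2P : volterra_kernel T k2 C2.
Hypothesis k3P : volterra_kernel T k3 C3.
Variables (Ma Mb S : R).
Hypothesis Ma_ge0 : 0 <= Ma.
Hypothesis a_bounded : forall u v, `|a u v| <= Ma * `|u| * `|v|.
Hypothesis Mb_ge0 : 0 <= Mb.
Hypothesis b_bounded : forall v q, `|b v q| <= Mb * `|v| * `|q|.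

Definition saddle_spec (phi : V -> R) (psi : Q -> R) (x : V * Q) :=
  forall v q, a x.1 v + b v x.2 = phi v /\ b x.1 q = psi q.

Hypothesis saddle_solvable : forall phi psi,
  bounded_functional phi -> bounded_functional psi ->
  exists x : V * Q, saddle_spec phi psi x.
Hypothesis S_ge0 : 0 <= S.
Hypothesis saddle_bound : forall (x : V * Q) e, 0 <= e ->
  (forall v, `|a x.1 v + b v x.2| <= e * `|v|) ->
  (forall q, `|b x.1 q| <= e * `|q|) -> `|x| <= S * e.

Local Notation mu := (@lebesgue_measure R).
Local Notation aeF := (ae_filter_ringOfSetsType mu).
Local Notation J := (`[0, T]%classic : set R).

Lemma saddle_spec_stable phi psi phi' psi' x x' e : 0 <= e ->
  saddle_spec phi psi x -> saddle_spec phi' psi' x' ->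
  (forall v, `|phi v - phi' v| <= e * `|v|) ->
  (forall q, `|psi q - psi' q| <= e * `|q|) -> `|x - x'| <= S * e.
Proof.
move=> e0 hx hx' hphi hpsi; apply: saddle_bound => //.
  move=> v; have [E _] := hx v 0; have [E' _] := hx' v 0.
  rewrite linearBl linearBr /= addrACA -opprD E E'.
  exact: hphi.
move=> q; have [_ E] := hx 0 q; have [_ E'] := hx' 0 q.
by rewrite linearBl /= E E'; exact: hpsi.
Qed.

Lemma saddle_spec_unique phi psi x x' :
  saddle_spec phi psi x -> saddle_spec phi psi x' -> x = x'.
Proof.
move=> hx hx'; apply/subr0_eq/eqP; rewrite -normr_le0.
have := saddle_spec_stable (lexx 0) hx hx'.
by rewrite mulr0; apply => w; rewrite subrr normr0 mul0r.
Qed.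

Lemma saddle_specD phi psi phi' psi' x x' :
  saddle_spec phi psi x -> saddle_spec phi' psi' x' ->
  saddle_spec (fun v => phi v + phi' v) (fun q => psi q + psi' q) (x + x').
Proof.
move=> hx hx' v q; have [E1 E2] := hx v q; have [E1' E2'] := hx' v q.
by rewrite linearDl linearDr /= linearDl /= -E1 -E1' -E2 -E2'; split; ring.
Qed.

Definition saddle_solve phi psi : V * Q :=
  xget 0 [set x | saddle_spec phi psi x].

Lemma saddle_solveP phi psi :
  bounded_functional phi -> bounded_functional psi ->
  saddle_spec phi psi (saddle_solve phi psi).
Proof.
by move=> bphi bpsi; exact: (xgetPex 0 (saddle_solvable bphi bpsi)).
Qed.

(** The stationary solution operator is Lipschitz on pairs of functionals, hence
    it preserves limits of simple functions and integrability. *)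
Lemma saddle_solve_data (f : R -> dual V) (g : R -> dual Q) :
  L1_fun T f -> L1_fun T g -> L1_fun T (fun t => saddle_solve (f t) (g t)).
Proof.
move=> [mf intf] [mg intg].
pose sol (z : dual V * dual Q) := saddle_solve z.1 z.2.
have solP (z : dual V * dual Q) : saddle_spec z.1 z.2 (sol z).
  by apply: saddle_solveP; exact: dual_bounded_functional.
have lip z z' : `|sol z - sol z'| <= S * `|z - z'|.
  apply: saddle_spec_stable (solP z) (solP z') _ _ => [//|v|q].
    apply: le_trans (dual_norm_bound (z - z').1 v) _.
    by rewrite ler_wpM2r// [leRHS]prod_normE le_max lexx.
  apply: le_trans (dual_norm_bound (z - z').2 q) _.
  by rewrite ler_wpM2r// [leRHS]prod_normE le_max lexx orbT.
have sol_cont : continuous sol.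
  move=> z; apply/cvgrPdist_le => e e0.
  have S1 : 0 < S + 1 by rewrite ltr_wpDl.
  have /cvgrPdist_le/(_ (e / (S + 1))) := @cvg_id _ (nbhs z).
  rewrite divr_gt0// => /(_ isT); apply: filterS => z' zz'.
  rewrite (le_trans (lip _ _))// (@le_trans _ _ ((S + 1) * `|z - z'|))//.
    by rewrite ler_wpM2r// lerDl.
  by rewrite mulrC -ler_pdivlMr.
have msol : pw_measurable J (fun t => saddle_solve (f t) (g t)).
  exact: pw_measurable_comp sol_cont (pw_measurable_pair mf mg).
split=> //.
have : mu.-integrable J (fun t => S%:E * ((`|f t|)%:E + (`|g t|)%:E))%E.
  by apply: integrableZl => //; exact: integrableD.
apply: le_integrable => //.
  by apply/measurable_EFinP; exact: pw_measurable_norm.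
move=> t _; rewrite /= lee_fin normr_id ger0_norm ?mulr_ge0 ?addr_ge0//.
apply: saddle_bound => [|v|q]; first by rewrite addr_ge0.
  have [-> _] := solP (f t, g t) v 0.
  rewrite (le_trans (dual_norm_bound _ _))// ler_wpM2r//.
  by rewrite lerDl.
have [_ ->] := solP (f t, g t) 0 q.
rewrite (le_trans (dual_norm_bound _ _))// ler_wpM2r//.
by rewrite lerDr.
Qed.

Let c1 (x : V * Q) (v : V) := a x.1 v.
Let c2 (x : V * Q) (v : V) := b v x.2.
Let c3 (x : V * Q) (q : Q) := b x.1 q.

Let norm1 (x : V * Q) : `|x.1| <= `|x|.
Proof. by rewrite [leRHS]prod_normE le_max lexx. Qed.

Let norm2 (x : V * Q) : `|x.2| <= `|x|.
Proof. by rewrite [leRHS]prod_normE le_max lexx orbT. Qed.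

Let c1_linear_l r x x' y : c1 (r *: x + x') y = r * c1 x y + c1 x' y.
Proof. exact: linearPl. Qed.
Let c1_linear_r r x y y' : c1 x (r *: y + y') = r * c1 x y + c1 x y'.
Proof. exact: linearPr. Qed.
Let c2_linear_l r x x' y : c2 (r *: x + x') y = r * c2 x y + c2 x' y.
Proof. exact: linearPr. Qed.
Let c2_linear_r r x y y' : c2 x (r *: y + y') = r * c2 x y + c2 x y'.
Proof. exact: linearPl. Qed.
Let c3_linear_l r x x' y : c3 (r *: x + x') y = r * c3 x y + c3 x' y.
Proof. exact: linearPl. Qed.
Let c3_linear_r r x y y' : c3 x (r *: y + y') = r * c3 x y + c3 x y'.
Proof. exact: linearPr. Qed.
Let c1_bounded x v : `|c1 x v| <= Ma * `|x| * `|v|.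
Proof.
by apply: le_trans (a_bounded _ _) _; rewrite ler_wpM2r// ler_wpM2l.
Qed.
Let c2_bounded x v : `|c2 x v| <= Mb * `|x| * `|v|.
Proof.
by apply: le_trans (b_bounded _ _) _; rewrite mulrAC ler_wpM2r// ler_wpM2l.
Qed.
Let c3_bounded x q : `|c3 x q| <= Mb * `|x| * `|q|.
Proof.
by apply: le_trans (b_bounded _ _) _; rewrite ler_wpM2r// ler_wpM2l.
Qed.

Definition memory_functional (x : R -> V * Q) t v :=
  kernel_integral T k1 c1 x t v + kernel_integral T k2 c2 x t v.

Definition memory_constraint (x : R -> V * Q) t q :=
  kernel_integral T k3 c3 x t q.

Lemma memory_functional_bounded x t : L1_fun T x ->
  bounded_functional (memory_functional x t).
Proof.
move=> Lx.
have [l1 [N1 h1]] := kernel_integral_functional T_ge0 k1P c1_linear_l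
  c1_linear_r c1_bounded t Lx.
have [l2 [N2 h2]] := kernel_integral_functional T_ge0 k2P c2_linear_l
  c2_linear_r c2_bounded t Lx.
split=> [r v w|]; first by rewrite /memory_functional l1 l2; ring.
exists (N1 + N2) => v; rewrite mulrDl (le_trans (ler_normD _ _))//.
exact: lerD.
Qed.

Lemma memory_constraint_bounded x t : L1_fun T x ->
  bounded_functional (memory_constraint x t).
Proof.
move=> Lx.
exact: (kernel_integral_functional T_ge0 k3P c3_linear_l c3_linear_r
  c3_bounded t Lx).
Qed.

Definition memory_operator (x : R -> V * Q) t : V * Q :=
  saddle_solve (memory_functional x t) (memory_constraint x t).

Lemma memory_operatorP x t : L1_fun T x ->
  saddle_spec (memory_functional x t) (memory_constraint x t)
    (memory_operator x t).
Proof.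
move=> Lx; apply: saddle_solveP; first exact: memory_functional_bounded.
exact: memory_constraint_bounded.
Qed.

(** The summand 1 only serves to make the constant positive. *)
Lemma memory_operator_lipschitz x x' t : L1_fun T x -> L1_fun T x' -> J t ->
  `|memory_operator x t - memory_operator x' t| <=
  (S * (Ma * C1 + Mb * C2 + Mb * C3) + 1) *
    \int[mu]_(s in `[0, t]) `|x s - x' s|.
Proof.
move=> Lx Lx' Jt; set I := \int[mu]_(s in _) _.
have I0 : 0 <= I by apply: Rintegral_ge0 => s _.
have C10 := kernel_bound_ge0 T_ge0 k1P.
have C20 := kernel_bound_ge0 T_ge0 k2P.
have C30 := kernel_bound_ge0 T_ge0 k3P.
apply: (@le_trans _ _ (S * ((Ma * C1 + Mb * C2 + Mb * C3) * I))); last first.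
  by rewrite mulrA ler_wpM2r// lerDl.
have [D1 [D2 D3]] : 0 <= Ma * C1 /\ 0 <= Mb * C2 /\ 0 <= Mb * C3.
  by rewrite !mulr_ge0.
apply: saddle_spec_stable (memory_operatorP t Lx) (memory_operatorP t Lx') _ _.
- by rewrite mulr_ge0// !addr_ge0.
- move=> v; rewrite /memory_functional opprD addrACA.
  rewrite (le_trans (ler_normD _ _))//.
  apply: (@le_trans _ _ (Ma * C1 * I * `|v| + Mb * C2 * I * `|v|)).
    apply: lerD.
      exact: (kernel_integral_lipschitz T_ge0 k1P Ma_ge0 c1_linear_l
      c1_bounded v Lx Lx' Jt).
    exact: (kernel_integral_lipschitz T_ge0 k2P Mb_ge0 c2_linear_l
      c2_bounded v Lx Lx' Jt).
  by rewrite -!mulrDl ler_wpM2r// ler_wpM2r// lerDl.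
- move=> q; rewrite /memory_constraint.
  apply: (@le_trans _ _ (Mb * C3 * I * `|q|)).
    exact: (kernel_integral_lipschitz T_ge0 k3P Mb_ge0 c3_linear_l
      c3_bounded q Lx Lx' Jt).
  by rewrite ler_wpM2r// ler_wpM2r// lerDr addr_ge0.
Qed.

Lemma memory_operator_continuous x : L1_fun T x ->
  continuous (memory_operator x).
Proof.
move=> Lx t.
pose w k t' := kernel_modulus T k x t t'.
have w0 k t' : 0 <= w k t' by apply: Rintegral_ge0 => s _; rewrite mulr_ge0.
pose e t' := Ma * w k1 t' + Mb * w k2 t' + Mb * w k3 t'.
have ecvg : S * e t' @[t' --> t] --> S * (Ma * 0 + Mb * 0 + Mb * 0).
  apply: cvgMr; apply: cvgD; [apply: cvgD|]; apply: cvgMr.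
  - exact: (kernel_modulus_cvg T_ge0 k1P t Lx).
  - exact: (kernel_modulus_cvg T_ge0 k2P t Lx).
  - exact: (kernel_modulus_cvg T_ge0 k3P t Lx).
rewrite !mulr0 !addr0 mulr0 in ecvg.
apply/cvgrPdist_lt => d d0.
have /cvgrPdist_lt/(_ _ d0) := ecvg; apply: filterS => t'.
rewrite sub0r normrN => hd; apply: le_lt_trans hd.
have [D1 [D2 D3]] : 0 <= Ma * w k1 t' /\ 0 <= Mb * w k2 t' /\ 0 <= Mb * w k3 t'.
  by rewrite !mulr_ge0.
apply: le_trans (ler_norm _).
apply: saddle_spec_stable (memory_operatorP t Lx) (memory_operatorP t' Lx) _ _.
- by rewrite !addr_ge0.
- move=> v; rewrite /memory_functional opprD addrACA.
  rewrite (le_trans (ler_normD _ _))//.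
  apply: (@le_trans _ _ (Ma * w k1 t' * `|v| + Mb * w k2 t' * `|v|)).
    apply: lerD.
      exact: (kernel_integral_continuous T_ge0 k1P c1_linear_l
      c1_bounded t t' v Lx).
    exact: (kernel_integral_continuous T_ge0 k2P c2_linear_l
      c2_bounded t t' v Lx).
  by rewrite -mulrDl ler_wpM2r// lerDl.
- move=> q; rewrite /memory_constraint.
  apply: (@le_trans _ _ (Mb * w k3 t' * `|q|)).
    exact: (kernel_integral_continuous T_ge0 k3P c3_linear_l
      c3_bounded t t' q Lx).
  by rewrite ler_wpM2r// lerDr addr_ge0.
Qed.

Lemma memory_functionalE x t v : L1_fun T x -> J t ->
  \int[mu]_(s in `[0, t]) (k1 t s * a (x s).1 v + k2 t s * b v (x s).2) =
  memory_functional x t v.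
Proof.
move=> Lx Jt.
rewrite /memory_functional /kernel_integral -RintegralD//; last 2 first.
- exact: (kernel_integrable T_ge0 k1P c1_linear_l c1_bounded t v Lx).
- exact: (kernel_integrable T_ge0 k2P c2_linear_l c2_bounded t v Lx).
apply: Rintegral_cutoff => // s ts.
  by rewrite !(cutoff_kernelE _ Jt ts).
by rewrite !cutoff_kernel0// !mul0r addr0.
Qed.

Lemma memory_constraintE x t q : J t ->
  \int[mu]_(s in `[0, t]) (k3 t s * b (x s).1 q) = memory_constraint x t q.
Proof.
move=> Jt; apply: Rintegral_cutoff => // s ts.
  by rewrite (cutoff_kernelE _ Jt ts).
by rewrite cutoff_kernel0// mul0r.
Qed.

(** By linearity, the solution with the sum of two data is the sum of the
    solutions, so at time t the equations are a fixed-point equation. *)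
Lemma saddle_equationsP (f : dual V) (g : dual Q) x t : L1_fun T x -> J t ->
  (forall v q,
    a (x t).1 v + b v (x t).2 = f v +
      \int[mu]_(s in `[0, t]) (k1 t s * a (x s).1 v + k2 t s * b v (x s).2) /\
    b (x t).1 q = g q + \int[mu]_(s in `[0, t]) (k3 t s * b (x s).1 q)) <->
  x t = saddle_solve f g + memory_operator x t.
Proof.
move=> Lx Jt.
have hx : saddle_spec (fun v => f v + memory_functional x t v)
    (fun q => g q + memory_constraint x t q)
    (saddle_solve f g + memory_operator x t).
  apply: saddle_specD; last exact: memory_operatorP.
  by apply: saddle_solveP; exact: dual_bounded_functional.
split=> [eqx|-> v q]; last first.
  by rewrite memory_functionalE// memory_constraintE.
apply: saddle_spec_unique hx => v q.
by rewrite -memory_functionalE// -memory_constraintE.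
Qed.

Variables (f : R -> dual V) (g : R -> dual Q).
Hypotheses (Lf : bochner_L1 mu J f) (Lg : bochner_L1 mu J g).

Theorem saddle_volterra_well_posed : exists (u : R -> V) (p : R -> Q),
  [/\ bochner_L1 mu J (fun t => (u t, p t) : V * Q),
      volterra_saddle_solution T k1 k2 k3 a b f g u p
    & forall (u' : R -> V) (p' : R -> Q),
        bochner_L1 mu J (fun t => (u' t, p' t) : V * Q) ->
        volterra_saddle_solution T k1 k2 k3 a b f g u' p' ->
        ae_eq mu J u' u /\ ae_eq mu J p' p].
Proof.
have [f0 Lf0 ff0] := bochner_version Lf.
have [g0 Lg0 gg0] := bochner_version Lg.
pose h t := saddle_solve (f0 t) (g0 t).
have Lh : L1_fun T h by exact: saddle_solve_data.
have C10 := kernel_bound_ge0 T_ge0 k1P.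
have C20 := kernel_bound_ge0 T_ge0 k2P.
have C30 := kernel_bound_ge0 T_ge0 k3P.
have C_gt0 : 0 < S * (Ma * C1 + Mb * C2 + Mb * C3) + 1.
  by rewrite ltr_wpDl// mulr_ge0// !addr_ge0// mulr_ge0.
have [x Lx xP] := volterra_exists T_ge0 (@prod_geometric_cvg R V Q) C_gt0
  memory_operator_continuous memory_operator_lipschitz Lh.
have xE t : ((x t).1, (x t).2) = x t by rewrite -surjective_pairing.
exists (fun t => (x t).1), (fun t => (x t).2); split.
- under [X in bochner_L1 _ _ X]eq_fun do rewrite xE.
  exact: L1_fun_bochner.
- apply: (@filterS2 _ _ aeF) ff0 gg0 => t ff0 gg0 Jt.
  rewrite ff0// gg0//; apply/saddle_equationsP => //.
  exact: xP.
- move=> u' p' /bochner_version[y Ly yE] sol.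
  (* The equations satisfied by (u', p') pass to its representative [y]. *)
  have eq_int (F : V * Q -> R -> R) t : J t ->
      \int[mu]_(s in `[0, t]) F (u' s, p' s) s =
      \int[mu]_(s in `[0, t]) F (y s) s.
    move=> Jt; congr fine; apply: ae_eq_integral_nonmeasurable => //.
    apply: (@filterS _ _ aeF) yE => s yE /=; rewrite in_itv/= => /andP[s0 st].
    rewrite yE//= in_itv/= s0 (le_trans st)//.
    by move: Jt; rewrite /= in_itv/= => /andP[].
  have yP : {ae mu, forall t, J t -> y t = h t + memory_operator y t}.
    apply: (@filterS3 _ _ aeF) ff0 gg0 (@filterI _ _ aeF _ _ sol yE).
    move=> t ff0 gg0 [st yEt] Jt.
    apply/saddle_equationsP => // v q.
    have [E1 E2] := st Jt v q; rewrite -ff0// -gg0// -yEt//=; split.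
      rewrite E1; congr (_ + _).
      exact: (eq_int (fun x s => k1 t s * a x.1 v + k2 t s * b v x.2)).
    rewrite E2; congr (_ + _).
    exact: (eq_int (fun x s => k3 t s * b x.1 q)).
  have yx : ae_eq mu J y x.
    apply: (volterra_unique T_ge0 C_gt0 memory_operator_lipschitz Ly Lx yP).
    by apply: aeW => t; exact: xP.
  split; apply: (@filterS2 _ _ aeF) yE yx => t yE yx Jt.
    by rewrite -yx// -yE.
  by rewrite -yx// -yE.
Qed.

End SaddleVolterra.

Theorem theorem2p3 (R : realType) (V Q : hilbertType R) (T : R)
  (k1 k2 k3 : R -> R -> R) (C1 C2 C3 : R)
  (a : {bilinear V -> V -> R}) (b : {bilinear V -> Q -> R}) (alpha0 : R)
  (T_ge0 : 0 <= T)
  (k1_kernel : volterra_kernel T k1 C1)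
  (k2_kernel : volterra_kernel T k2 C2)
  (k3_kernel : volterra_kernel T k3 C3)
  (a_sym : forall u v : V, a u v = a v u)
  (a_psd : forall v : V, 0 <= a v v)
  (a_cont : continuous (fun x : V * V => a x.1 x.2))
  (b_cont : continuous (fun x : V * Q => b x.1 x.2))
  (alpha0_gt0 : 0 < alpha0)
  (a_coercive : forall v0 : V, ker_op b_cont v0 ->
    alpha0 * `|v0| ^+ 2 <= a v0 v0)
  (B_onto : range (induced_op b_cont) = [set: dual Q]) :
  let mu := @lebesgue_measure R in
  let J : set R := `[0, T]%classic in
  forall (f : R -> dual V) (g : R -> dual Q),
    bochner_L1 mu J f -> bochner_L1 mu J g ->
    exists (u : R -> V) (p : R -> Q),
      [/\ bochner_L1 mu J (fun t => (u t, p t) : V * Q),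
          volterra_saddle_solution T k1 k2 k3 a b f g u p
        & forall (u' : R -> V) (p' : R -> Q),
            bochner_L1 mu J (fun t => (u' t, p' t) : V * Q) ->
            volterra_saddle_solution T k1 k2 k3 a b f g u' p' ->
            ae_eq mu J u' u /\ ae_eq mu J p' p].
Proof.
move=> mu J f g Lf Lg.
have [Ma /ltW Ma0 a_bnd] := bilinear_schwarz a_cont.
have [Mb /ltW Mb0 b_bnd] := bilinear_schwarz b_cont.
have [S S0 S_bnd] := saddle_stable B_onto a_cont alpha0_gt0 a_coercive.
exact: (saddle_volterra_well_posed T_ge0 k1_kernel k2_kernel k3_kernel
  Ma0 a_bnd Mb0 b_bnd
  (saddle_exists B_onto a_sym a_cont alpha0_gt0 a_coercive) S0 S_bnd Lf Lg).
Qed.
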